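(* Let $p\ge1$, $m=2p$. The set of Weyl functions on the semiaxis (see context) of all systems $W_{k+1}(\lambda)-W_k(\lambda)=-\frac{i}{\lambda}jC_kW_k(\lambda)$, $k\ge0$, with $C_k=2K^*\beta(k)^*\beta(k)K-j$ for $p\times m$ matrices $\beta(k)$ satisfying $\beta(k)J\beta(k)^*=I_p$, coincides with the set of $p\times p$ matrix functions $\varphi$ such that $$i\varphi\Big(i\frac{z+1}{z-1}\Big)=\alpha_0+\sum_{k=1}^\infty s_{-k}z^k$$ is a Carath\'eodory matrix function in the unit disc and the block Toeplitz matrices $\{s_{j-k}\}_{k,j=0}^N$ are positive definite for all $0\le N<\infty$, where $s_0:=\alpha_0+\alpha_0^*$ and $s_k:=s_{-k}^*$. Moreover, such a system is uniquely determined by its Weyl function: for every $N\ge0$, with $\alpha_k:=s_{-k}$ ($1\le k\le N$), $\Phi_1$ the $(N+1)p\times p$ block column of identities, $\Phi_2$ the block column with blocks $\alpha_0,\alpha_0+\alpha_1,\dots,\alpha_0+\dots+\alpha_N$, $\Pi=[\Phi_1\ \Phi_2]$, $A=\{a_{j-k}\}_{k,j=0}^N$ with $a_r=0$ ($r>0$), $a_0=\frac i2I_p$, $a_r=iI_p$ ($r<0$), the identity $AS-SA^*=i\Pi J\Pi^*$ has a unique solution $S>0$ and $\Pi^*S^{-1}\Pi=\sum_{k=0}^N\beta(k)^*\beta(k)$.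
   Context: $j=\mathrm{diag}(I_p,-I_p)$, $J=\begin{bmatrix}0&I_p\\ I_p&0\end{bmatrix}$, $K=\frac1{\sqrt2}\begin{bmatrix}I_p&-I_p\\ I_p&I_p\end{bmatrix}$, $\mathbb C_-$ the open lower half-plane, $q(\lambda)=|\lambda|^2(|\lambda|^2+1)^{-1}$, $W_k$ the solution with $W_0=I_m$. A Weyl function on the semiaxis is a $p\times p$ matrix function $\varphi$ holomorphic in $\mathbb C_-$ such that for every $\lambda\in\mathbb C_-$ the series $\sum_{k=0}^\infty[i\varphi(\lambda)^*\ \ I_p]q(\lambda)^kKW_k(\lambda)^*C_kW_k(\lambda)K^*\begin{bmatrix}-i\varphi(\lambda)\\ I_p\end{bmatrix}$ converges. A Carath\'eodory matrix function in the unit disc is a matrix function $F$ holomorphic in $|z|<1$ with $F(z)+F(z)^*\ge0$ there. *)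

(* Defs.v *)
From HB Require Import structures.
From mathcomp Require Import all_boot all_order all_algebra.
From mathcomp Require Import complex.
From mathcomp Require Import all_classical all_reals all_analysis.
Set Implicit Arguments. Unset Strict Implicit. Unset Printing Implicit Defensive.
Import Order.TTheory GRing.Theory Num.Theory.
Import numFieldTopology.Exports numFieldNormedType.Exports.
Local Open Scope ring_scope.
Local Open Scope classical_set_scope.

Section Defs.
Variable R : realType.
Local Notation C := R[i].
Variable p : nat.

Definition adj {a b} (A : 'M[C]_(a, b)) : 'M[C]_(b, a) := (map_mx Num.conj A)^T.

Definition posdef {n} (S : 'M[C]_n) : Prop :=
  adj S = S /\ forall v : 'cV[C]_n, v != 0 -> 0 < (adj v *m S *m v) 0 0.
Definition psd {n} (M : 'M[C]_n) : Prop :=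
  adj M = M /\ forall v : 'cV[C]_n, 0 <= (adj v *m M *m v) 0 0.

(* the matrix space 'M[C]_(a,b) seen as a normed C-module (max-entry norm,
   MathComp-Analysis' matrix_normedtype); used to fix the topology *)
Definition MX (a b : nat) : normedModType C := 'M[C]_(a, b).

Definition series_to {a b} (u : nat -> 'M[C]_(a, b)) (l : 'M[C]_(a, b)) : Prop :=
  ((fun n => \sum_(0 <= k < n) u k) : nat -> MX a b) @ \oo --> (l : MX a b).
Definition series_cvg {a b} (u : nat -> 'M[C]_(a, b)) : Prop :=
  exists l, series_to u l.

(* holomorphy on a set: complex differentiability at every point
   (derivative along 1 with complex increments h -> 0) *)
Definition holomorphic_on {a b} (D : set C) (f : C -> 'M[C]_(a, b)) : Prop :=
  forall z, D z -> derivable (f : C^o -> MX a b) z 1.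

Definition Clower : set C := [set z | complex.Im z < 0].
Definition udisc : set C := [set z | `|z| < 1].

Definition caratheodory {n} (F : C -> 'M[C]_n) : Prop :=
  holomorphic_on udisc F /\ forall z, udisc z -> psd (F z + adj (F z)).

Definition jm : 'M[C]_(p + p) := block_mx 1%:M 0 0 (- 1%:M).
Definition Jm : 'M[C]_(p + p) := block_mx 0 1%:M 1%:M 0.
Definition Km : 'M[C]_(p + p) :=
  (sqrtC 2)^-1 *: block_mx 1%:M (- 1%:M) 1%:M 1%:M.

Definition admissible (beta : nat -> 'M[C]_(p, p + p)) : Prop :=
  forall k, beta k *m Jm *m adj (beta k) = 1%:M.

Definition Csys (beta : nat -> 'M[C]_(p, p + p)) (k : nat) : 'M[C]_(p + p) :=
  2%:R *: (adj Km *m adj (beta k) *m beta k *m Km) - jm.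

Fixpoint Wsys (beta : nat -> 'M[C]_(p, p + p)) (lam : C) (k : nat)
  : 'M[C]_(p + p) :=
  match k with
  | 0 => 1%:M
  | k'.+1 => Wsys beta lam k' - ('i%C / lam) *: (jm *m Csys beta k' *m Wsys beta lam k')
  end.

Definition qf (lam : C) : C := `|lam| ^+ 2 / (`|lam| ^+ 2 + 1).

Definition weyl_term (beta : nat -> 'M[C]_(p, p + p)) (phi : C -> 'M[C]_p)
  (lam : C) (k : nat) : 'M[C]_p :=
  row_mx ('i%C *: adj (phi lam)) 1%:M
  *m (qf lam ^+ k *: (Km *m adj (Wsys beta lam k) *m Csys beta k
                        *m Wsys beta lam k *m adj Km))
  *m col_mx (- 'i%C *: phi lam) 1%:M.

Definition weyl_function (beta : nat -> 'M[C]_(p, p + p)) (phi : C -> 'M[C]_p)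
  : Prop :=
  holomorphic_on Clower phi /\
  forall lam, Clower lam -> series_cvg (weyl_term beta phi lam).

Definition mob (z : C) : C := 'i%C * (z + 1) / (z - 1).

(* i phi(i(z+1)/(z-1)) = alpha0 + sum_{k>=1} s_{-k} z^k on |z|<1,
   where  s k  stands for  s_{-k}  (k >= 1; s 0 is unused) *)
Definition expansion (phi : C -> 'M[C]_p) (alpha0 : 'M[C]_p)
  (s : nat -> 'M[C]_p) : Prop :=
  forall z, udisc z ->
    series_to (fun k => z ^+ k.+1 *: s k.+1) ('i%C *: phi (mob z) - alpha0).

Definition toeplitz (N : nat) (alpha0 : 'M[C]_p) (s : nat -> 'M[C]_p)
  : 'M[C]_(\sum_(k < N.+1) p) :=
  \mxblock_(k < N.+1, j < N.+1)
    (if (j < k)%N then s (k - j)%N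
     else if j == k then alpha0 + adj alpha0
     else adj (s (j - k)%N)).

Definition alph (alpha0 : 'M[C]_p) (s : nat -> 'M[C]_p) (k : nat) : 'M[C]_p :=
  if k is 0 then alpha0 else s k.

Definition PiN (N : nat) (alpha0 : 'M[C]_p) (s : nat -> 'M[C]_p)
  : 'M[C]_(\sum_(k < N.+1) p, p + p) :=
  row_mx (\mxcol_(k < N.+1) (1%:M : 'M[C]_p))
         (\mxcol_(k < N.+1) (\sum_(l < k.+1) alph alpha0 s l)).

Definition AN (N : nat) : 'M[C]_(\sum_(k < N.+1) p) :=
  \mxblock_(k < N.+1, j < N.+1)
    (if (k < j)%N then (0 : 'M[C]_p)
     else if j == k then ('i%C / 2%:R) *: 1%:M
     else 'i%C *: 1%:M).

End Defs.

(* Main.v *)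
Require Import Defs.
From HB Require Import structures.
From mathcomp Require Import all_boot all_order all_algebra.
From mathcomp Require Import complex.
From mathcomp Require Import all_classical all_reals all_analysis.
From mathcomp Require Import ring lra zify.
Set Implicit Arguments.
Unset Strict Implicit.
Unset Printing Implicit Defensive.
Import Order.TTheory GRing.Theory Num.Theory.
Import numFieldTopology.Exports numFieldNormedType.Exports.
Local Open Scope ring_scope.
Local Open Scope classical_set_scope.

(** In the coordinates W -> K W K^*, one step of the system multiplies by a scalar times
    P_k + z (1 - P_k), where P_k = J beta_k^* beta_k is a projector whose range is
    J-positive and whose kernel is J-negative, and z is the Cayley transform of lambda.
    The indefinite energy q^k w_k^* J w_k increases by a positive multiple of the k-th
    Weyl term, so the Weyl series converges iff all energies are nonpositive.

    Systems and Toeplitz sequences are matched through a block lower triangular X with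
    X X^* = T (the Toeplitz matrix), whose rows satisfy sum_l X_nl beta_l =
    [1, alpha_0 + ... + alpha_n] and turn the strictly lower triangular part of
    (beta_k J beta_j^* ) into the summation operator.  Solving triangular systems gives X
    from beta, and block Cholesky factorization gives X and beta from T.  With
    psi_k = sum_n z^n X_nk the row r_n = sum_(k >= n) (1 - z) psi_k beta_k satisfies
    r_n J r_n^* = (1 - |z|^2) sum_(k >= n) psi_k psi_k^* >= 0 and annihilates the solution
    w_n starting at [- F; 1] where F(z) = alpha_0 + sum_k alpha_k z^k; the signature of J
    then forces w_n^* J w_n <= 0, so F is the Weyl function.  Finally, at most one F makes
    the Weyl series converge, since beta_0 restricted to its first p columns is
    invertible. *)

Section Adjoint.
Variable R : realType.
Local Notation C := R[i].

Lemma adjE a b (A : 'M[C]_(a, b)) i j : adj A i j = (A j i)^*.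
Proof. by rewrite !mxE. Qed.

Lemma adjK a b (A : 'M[C]_(a, b)) : adj (adj A) = A.
Proof. by apply/matrixP => i j; rewrite !adjE conjCK. Qed.

Lemma adjM a b c (A : 'M[C]_(a, b)) (B : 'M[C]_(b, c)) :
  adj (A *m B) = adj B *m adj A.
Proof. by rewrite /adj map_mxM trmx_mul. Qed.

Lemma adjD a b (A B : 'M[C]_(a, b)) : adj (A + B) = adj A + adj B.
Proof. by apply/matrixP => i j; rewrite !mxE rmorphD. Qed.

Lemma adjN a b (A : 'M[C]_(a, b)) : adj (- A) = - adj A.
Proof. by apply/matrixP => i j; rewrite !mxE rmorphN. Qed.

Lemma adjB a b (A B : 'M[C]_(a, b)) : adj (A - B) = adj A - adj B.
Proof. by rewrite adjD adjN. Qed.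

Lemma adjZ a b k (A : 'M[C]_(a, b)) : adj (k *: A) = k^* *: adj A.
Proof. by apply/matrixP => i j; rewrite !mxE rmorphM. Qed.

Lemma adj0 a b : adj (0 : 'M[C]_(a, b)) = 0.
Proof. by apply/matrixP => i j; rewrite !mxE rmorph0. Qed.

Lemma adj1 n : adj (1%:M : 'M[C]_n) = 1%:M.
Proof. by rewrite /adj map_mx1 trmx1. Qed.

Lemma adj_sum a b (I : Type) (r : seq I) P (F : I -> 'M[C]_(a, b)) :
  adj (\sum_(k <- r | P k) F k) = \sum_(k <- r | P k) adj (F k).
Proof.
by elim/big_rec2 : _ => [|k x y _ <-]; [exact: adj0 | rewrite adjD].
Qed.

Lemma adj_row_mx a b c (A : 'M[C]_(a, b)) (B : 'M[C]_(a, c)) :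
  adj (row_mx A B) = col_mx (adj A) (adj B).
Proof. by rewrite /adj map_row_mx tr_row_mx. Qed.

Lemma adj_col_mx a b c (A : 'M[C]_(a, c)) (B : 'M[C]_(b, c)) :
  adj (col_mx A B) = row_mx (adj A) (adj B).
Proof. by rewrite /adj map_col_mx tr_col_mx. Qed.

Definition hform n (M : 'M[C]_n) (v : 'cV[C]_n) : C := (adj v *m M *m v) 0 0.

Lemma hformD n (M N : 'M[C]_n) v : hform (M + N) v = hform M v + hform N v.
Proof. by rewrite /hform mulmxDr mulmxDl mxE. Qed.

Lemma hformN n (M : 'M[C]_n) v : hform (- M) v = - hform M v.
Proof. by rewrite /hform mulmxN mulNmx mxE. Qed.

Lemma hformB n (M N : 'M[C]_n) v : hform (M - N) v = hform M v - hform N v.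
Proof. by rewrite hformD hformN. Qed.

Lemma hformZ n k (M : 'M[C]_n) v : hform (k *: M) v = k * hform M v.
Proof. by rewrite /hform -scalemxAr -scalemxAl mxE. Qed.

Lemma hform0 n v : hform (0 : 'M[C]_n) v = 0.
Proof. by rewrite /hform mulmx0 mul0mx mxE. Qed.

Lemma hform_sum n (I : Type) (r : seq I) P (F : I -> 'M[C]_n) v :
  hform (\sum_(k <- r | P k) F k) v = \sum_(k <- r | P k) hform (F k) v.
Proof.
by elim/big_rec2 : _ => [|k x y _ <-]; [exact: hform0 | rewrite hformD].
Qed.

Lemma hform_congr m n (B : 'M[C]_(m, n)) (M : 'M[C]_m) v :
  hform (adj B *m M *m B) v = hform M (B *m v).
Proof. by rewrite /hform adjM !mulmxA. Qed.

Lemma hform_real n (M : 'M[C]_n) v : adj M = M -> (hform M v)^* = hform M v.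
Proof.
by move=> hM; rewrite /hform -adjE !adjM adjK hM mulmxA.
Qed.

Lemma gram_entry m n (B : 'M[C]_(m, n)) i :
  (B *m adj B) i i = \sum_j `|B i j| ^+ 2.
Proof. by rewrite mxE; apply: eq_bigr => j _; rewrite adjE normCK. Qed.

Lemma gramv_ge0 n (v : 'cV[C]_n) : 0 <= (adj v *m v) 0 0.
Proof.
rewrite -[X in _ *m X]adjK gram_entry.
by apply: sumr_ge0 => j _; apply: exprn_ge0; exact: normr_ge0.
Qed.

Lemma gramv_eq0 n (v : 'cV[C]_n) : (adj v *m v) 0 0 = 0 -> v = 0.
Proof.
rewrite -[X in _ *m X]adjK gram_entry => /eqP.
rewrite psumr_eq0 => [/allP h|j _]; last exact/exprn_ge0/normr_ge0.
apply/matrixP => i j; rewrite ord1 mxE.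
have := h i (mem_index_enum _).
by rewrite adjE expf_eq0 /= normr_eq0 fmorph_eq0 => /eqP.
Qed.

Lemma hform1 n (v : 'cV[C]_n) : hform 1%:M v = (adj v *m v) 0 0.
Proof. by rewrite /hform mulmx1. Qed.

Lemma hform_gram m n (B : 'M[C]_(m, n)) v :
  hform (adj B *m B) v = (adj (B *m v) *m (B *m v)) 0 0.
Proof. by rewrite -[adj B]mulmx1 hform_congr hform1. Qed.

Lemma hform_gram_ge0 m n (B : 'M[C]_(m, n)) v : 0 <= hform (adj B *m B) v.
Proof. by rewrite hform_gram gramv_ge0. Qed.

Lemma hform_gram_eq0 m n (B : 'M[C]_(m, n)) v :
  hform (adj B *m B) v = 0 -> B *m v = 0.
Proof. by rewrite hform_gram => /gramv_eq0. Qed.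

Lemma unitmx_kernel n (A : 'M[C]_n) :
  (forall v : 'cV[C]_n, A *m v = 0 -> v = 0) -> A \in unitmx.
Proof.
move=> h; rewrite -unitmx_tr -row_free_unit -kermx_eq0; apply/eqP/row_matrixP => i.
rewrite row0; have /sub_kermxP : (row i (kermx A^T) <= kermx A^T)%MS by exact: row_sub.
move=> /(congr1 trmx); rewrite trmx_mul trmxK trmx0 => /h /(congr1 trmx).
by rewrite trmxK trmx0.
Qed.

Lemma unitmx_adj n (A : 'M[C]_n) : (adj A \in unitmx) = (A \in unitmx).
Proof. by rewrite /adj unitmx_tr map_unitmx. Qed.

Lemma adj_inj a b (A B : 'M[C]_(a, b)) : adj A = adj B -> A = B.
Proof. by move=> h; rewrite -(adjK A) h adjK. Qed.

Lemma hform_orthogonalD n (M : 'M[C]_n) (v w : 'cV[C]_n) :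
  adj M = M -> adj v *m M *m w = 0 -> hform M (v + w) = hform M v + hform M w.
Proof.
move=> hM vw; have wv : adj w *m M *m v = 0.
  by rewrite -[LHS]adjK adjM [adj (adj w *m M)]adjM adjK hM mulmxA vw adj0.
by rewrite /hform adjD !mulmxDl !mulmxDr vw wv addr0 add0r mxE.
Qed.

Lemma hform_subZ n (M : 'M[C]_n) c (v w : 'cV[C]_n) :
  hform M (v - c *: w) = hform M v - c * (adj v *m M *m w) 0 0
    - c^* * (adj w *m M *m v) 0 0 + c * c^* * hform M w.
Proof.
rewrite /hform adjB adjZ !mulmxBr !mulmxBl -!scalemxAr -!scalemxAl.
move: (adj v *m M *m v) (adj v *m M *m w) (adj w *m M *m v) (adj w *m M *m w).
by move=> vv vw wv ww; rewrite !mxE; ring.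
Qed.

Lemma hform_polar n (M : 'M[C]_n) (v w : 'cV[C]_n) :
  hform M (v + w) + hform M (v - w) = 2%:R * (hform M v + hform M w).
Proof.
rewrite /hform adjD adjB !mulmxDl !mulmxDr !mulNmx !mulmxN.
move: (adj v *m M *m v) (adj v *m M *m w) (adj w *m M *m v) (adj w *m M *m w).
by move=> vv vw wv ww; rewrite !mxE; ring.
Qed.

End Adjoint.

Section IndefiniteForm.
Variables (R : realType) (p : nat).
Local Notation C := R[i].
Local Notation J := (Jm R p).

Lemma adj_Jm : adj J = J.
Proof.
rewrite /Jm /block_mx adj_col_mx !adj_row_mx !adj0 !adj1.
by rewrite -/(block_mx _ _ _ _) block_mxEh.
Qed.

Lemma mulJJ : J *m J = 1%:M.
Proof.
rewrite /Jm mulmx_block !mul0mx !mul1mx !add0r !addr0.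
by rewrite -scalar_mx_block.
Qed.

Lemma hform_Jm (a c : 'cV[C]_p) :
  hform J (col_mx a c) = (adj a *m c) 0 0 + (adj c *m a) 0 0.
Proof.
rewrite /hform adj_col_mx /Jm mul_row_block !mulmx0 !mulmx1 add0r addr0.
by rewrite mul_row_col mxE addrC.
Qed.

(* The form of J is nonnegative on the span of J r^* and y; were it positive at y,
   this span would have dimension p + 1 and meet the p-dimensional negative subspace
   of vectors (a, -a). *)
Lemma Jm_orthogonal_le0 (r : 'M[C]_(p, p + p)) (y : 'cV[C]_(p + p)) :
  (forall v, 0 <= hform (r *m J *m adj r) v) ->
  (forall v : 'cV_p, adj r *m v = 0 -> v = 0) ->
  r *m y = 0 -> hform J y <= 0.
Proof.
move=> posr freer ry0.
have Jy_real : hform J y \is Num.real.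
  by apply/CrealP; rewrite hform_real ?adj_Jm.
case: (real_leP Jy_real (@real0 _)) => // Jy0.
pose G := row_mx (J *m adj r) y.
pose Z := usubmx G + dsubmx G.
have [c c0 Zc] : exists2 c : 'cV[C]_(p + 1), c != 0 & Z *m c = 0.
  have : kermx Z^T != 0.
    rewrite -mxrank_eq0 mxrank_ker mxrank_tr subn_eq0 -ltnNge.
    by apply: leq_ltn_trans (rank_leq_row Z) _; rewrite addn1.
  case/rowV0Pn => u /sub_kermxP h u0; exists u^T; first by rewrite trmx_eq0.
  by apply: trmx_inj; rewrite trmx_mul trmxK h trmx0.
have hG : hform J (G *m c)
    = hform (r *m J *m adj r) (usubmx c) + hform (hform J y)%:M (dsubmx c).
  have -> : hform (hform J y)%:M (dsubmx c) = hform (adj y *m J *m y) (dsubmx c).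
    by congr (hform _ _); rewrite [RHS]mx11_scalar.
  rewrite -{1}[c]vsubmxK mul_row_col hform_orthogonalD ?adj_Jm //; last first.
    rewrite !adjM adjK adj_Jm !mulmxA -(mulmxA _ J J) mulJJ mulmx1.
    by rewrite -(mulmxA _ r y) ry0 mulmx0 mul0mx.
  rewrite -!hform_congr (_ : _ *m J *m _ = r *m J *m adj r) //.
  by rewrite adjM adjK adj_Jm !mulmxA -(mulmxA _ J J) mulJJ mulmx1.
have hd : dsubmx (G *m c) = - usubmx (G *m c).
  by apply/eqP; rewrite -addr_eq0 -mul_usub_mx -mul_dsub_mx addrC -mulmxDl Zc.
have hG' : hform J (G *m c) = - 2%:R * (adj (usubmx (G *m c)) *m usubmx (G *m c)) 0 0.
  rewrite -{1}[G *m c]vsubmxK hform_Jm hd adjN mulmxN mulNmx !mxE.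
  by ring.
have hs : hform (hform J y)%:M (dsubmx c)
    = hform J y * (adj (dsubmx c) *m dsubmx c) 0 0.
  by rewrite -scalemx1 hformZ hform1.
have u0 : (adj (usubmx (G *m c)) *m usubmx (G *m c)) 0 0 = 0.
  apply/eqP; rewrite eq_le gramv_ge0 andbT.
  have : 0 <= - 2%:R * (adj (usubmx (G *m c)) *m usubmx (G *m c)) 0 0.
    by rewrite -hG' hG hs addr_ge0 // mulr_ge0 ?gramv_ge0 // ltW.
  by rewrite mulNr oppr_ge0 pmulr_rle0.
move: hG; rewrite hG' u0 mulr0 hs => /esym/eqP.
rewrite paddr_eq0 ?posr ?mulr_ge0 ?gramv_ge0 ?(ltW Jy0) // => /andP[_].
rewrite mulf_eq0 (gt_eqF Jy0) /= => /eqP/gramv_eq0 d0.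
have Gc0 : G *m c = 0.
  by rewrite -[G *m c]vsubmxK hd (gramv_eq0 u0) oppr0 col_mx0.
case/negP: c0; rewrite -[c]vsubmxK d0.
move: Gc0; rewrite -{1}[c]vsubmxK mul_row_col d0 mulmx0 addr0 => h.
have /freer -> : adj r *m usubmx c = 0.
  by move: (congr1 (mulmx J) h); rewrite !mulmxA mulJJ mul1mx mulmx0.
by rewrite col_mx0.
Qed.

Section Row.
Variable b : 'M[C]_(p, p + p).
Hypothesis bJb : b *m J *m adj b = 1%:M.

Lemma normalized_row_free (v : 'cV[C]_p) : adj b *m v = 0 -> v = 0.
Proof. by move=> h; rewrite -[v]mul1mx -bJb -mulmxA h mulmx0. Qed.

Lemma normalized_row_orthogonal (y : 'cV[C]_(p + p)) :
  b *m y = 0 -> hform J y <= 0.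
Proof.
apply: Jm_orthogonal_le0; last exact: normalized_row_free.
by move=> v; rewrite bJb hform1 gramv_ge0.
Qed.

Lemma normalized_row_Jm_le v : hform J v <= hform (adj b *m b) v.
Proof.
pose P := J *m adj b *m b.
have bP : b *m P = b by rewrite /P !mulmxA bJb mul1mx.
have JP : J *m P = adj b *m b by rewrite /P !mulmxA mulJJ mul1mx.
have : hform J ((1%:M - P) *m v) <= 0.
  apply: normalized_row_orthogonal.
  by rewrite mulmxA mulmxBr bP mulmx1 subrr mul0mx.
rewrite -hform_congr.
have -> : adj (1%:M - P) *m J *m (1%:M - P) = J - adj b *m b.
  rewrite -mulmxA mulmxBr JP mulmx1 adjB adj1 mulmxBl mul1mx.
  rewrite [X in _ - X](_ : _ = 0) ?subr0 //.
  rewrite mulmxBr mulmxA -adjM bP.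
  by rewrite /P !adjM adjK adj_Jm -!mulmxA mulJJ mulmx1 subrr.
by rewrite hformB subr_le0.
Qed.

Definition signature_mx := 2%:R *: (adj b *m b) - J.

Lemma hform_signature v :
  hform signature_mx v = 2%:R * hform (adj b *m b) v - hform J v.
Proof. by rewrite hformB hformZ. Qed.

Lemma adj_signature : adj signature_mx = signature_mx.
Proof. by rewrite adjB adjZ adjM adjK adj_Jm rmorph_nat. Qed.

Lemma signature_ge v : hform J v <= hform signature_mx v.
Proof.
rewrite hform_signature mulr_natl mulr2n -addrA.
have h := normalized_row_Jm_le v.
rewrite -subr_ge0 [X in 0 <= X](_ : _
  = (hform (adj b *m b) v - hform J v) + (hform (adj b *m b) v - hform J v)).
  by rewrite addr_ge0 // subr_ge0.
by ring.
Qed.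

Lemma signature_geN v : - hform J v <= hform signature_mx v.
Proof.
rewrite hform_signature -subr_ge0 opprK subrK.
by rewrite mulr_ge0 // hform_gram_ge0.
Qed.

Lemma signature_ge0 v : 0 <= hform signature_mx v.
Proof.
have h := lerD (signature_ge v) (signature_geN v).
by move: h; rewrite subrr -mulr2n -mulr_natl pmulr_rge0.
Qed.

Lemma signature_step c (w : 'cV[C]_(p + p)) :
  hform J (w - c *: (J *m signature_mx *m w))
  = (1 + c * c^*) * hform J w - (c + c^*) * hform signature_mx w.
Proof.
set S := signature_mx.
have SJS : S *m J *m S = J.
  have XJX : adj b *m b *m J *m (adj b *m b) = adj b *m b.
    by rewrite !mulmxA -(mulmxA _ b J) -(mulmxA (adj b)) bJb mulmx1.
  rewrite /S /signature_mx; move: XJX; set X := adj b *m b => XJX.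
  rewrite !(mulmxBl, mulmxBr) mulJJ !mul1mx -!scalemxAl -!scalemxAr.
  rewrite ?XJX -?(mulmxA X) mulJJ mulmx1.
  by apply/matrixP => i j; rewrite !mxE; ring.
have wJy : adj w *m J *m (J *m S *m w) = adj w *m S *m w.
  by rewrite !mulmxA -(mulmxA _ J J) mulJJ mulmx1.
have yJw : adj (J *m S *m w) *m J *m w = adj w *m S *m w.
  by rewrite !adjM adj_signature adj_Jm !mulmxA -(mulmxA _ J J) mulJJ mulmx1.
have yJy : hform J (J *m S *m w) = hform J w.
  rewrite -hform_congr adjM adj_signature adj_Jm !mulmxA -(mulmxA _ J J) mulJJ.
  by rewrite mulmx1 SJS.
rewrite hform_subZ wJy yJw yJy -/(hform S w).
by ring.
Qed.

End Row.

Lemma normalized_rows_unit (b b' : 'M[C]_(p, p + p)) :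
  b *m J *m adj b = 1%:M -> b' *m J *m adj b' = 1%:M ->
  b *m J *m adj b' \in unitmx.
Proof.
move=> hb hb'; rewrite -unitmx_adj; apply: unitmx_kernel => v.
rewrite !adjM adjK adj_Jm => h.
have h0 : hform J (J *m adj b *m v) <= 0.
  by apply: (normalized_row_orthogonal hb'); rewrite !mulmxA in h *.
have e : adj (J *m adj b) *m J *m (J *m adj b) = 1%:M.
  by rewrite adjM adjK adj_Jm -(mulmxA b) mulJJ mulmx1 !mulmxA hb.
move: h0; rewrite -hform_congr e hform1 => h0.
by apply: gramv_eq0; apply/eqP; rewrite eq_le h0 gramv_ge0.
Qed.

Lemma normalized_row_lsub_unit (b : 'M[C]_(p, p + p)) :
  b *m J *m adj b = 1%:M -> lsubmx b \in unitmx.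
Proof.
move=> hb; rewrite -unitmx_adj; apply: unitmx_kernel => v h.
move: hb; rewrite -{1 2}[b]hsubmxK adj_row_mx /Jm mul_row_block !mulmx0 !mulmx1.
rewrite add0r addr0 mul_row_col => hb.
apply: gramv_eq0.
rewrite -[X in _ *m X]mul1mx -hb mulmxDl mulmxDr -!mulmxA h !mulmx0 add0r.
by rewrite mulmxA -[lsubmx b]adjK -adjM h adj0 mul0mx mxE.
Qed.

End IndefiniteForm.

Lemma sum_ord_trunc (V : zmodType) (n N : nat) (F : nat -> V) : (n <= N)%N ->
  (forall l, (n <= l < N)%N -> F l = 0) -> \sum_(l < N) F l = \sum_(l < n) F l.
Proof.
move=> nN F0; rewrite -!(big_mkord xpredT) (big_cat_nat (n := n)) //=.
by rewrite [X in _ + X]big_nat_cond [X in _ + X]big1 ?addr0 // => l /andP[/F0].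
Qed.

Lemma cumulative_eq0 (V : zmodType) (N : nat) (D : nat -> nat -> V) :
  (forall k j, (k < N)%N -> (j < N)%N ->
     D k j + \sum_(m < k) D m j + \sum_(m < j) D k m = 0) ->
  forall k j, (k < N)%N -> (j < N)%N -> D k j = 0.
Proof.
move=> h k j; have [n] := ubnP (k + j); elim: n k j => // n IH k j kjn kN jN.
have := h k j kN jN; rewrite !big1 ?addr0 // => i _; have := ltn_ord i => ik; apply: IH; lia.
Qed.

Section Linked.
Variables (R : realType) (p : nat).
Local Notation C := R[i].
Local Notation J := (Jm R p).

Definition toeplitz_entry (al : nat -> 'M[C]_p) (k j : nat) : 'M[C]_p :=
  if (j < k)%N then al (k - j)%N
  else if j == k then al 0%N + adj (al 0%N) else adj (al (j - k)%N).

Lemma toeplitz_entryS al k j :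
  toeplitz_entry al k.+1 j.+1 = toeplitz_entry al k j.
Proof. by rewrite /toeplitz_entry ltnS !subSS eqSS. Qed.

Lemma toeplitz_entry_adj al k j :
  adj (toeplitz_entry al k j) = toeplitz_entry al j k.
Proof.
rewrite /toeplitz_entry; case: (ltngtP k j) => kj; rewrite ?kj.
- by rewrite adjK.
- by [].
- by rewrite adjD adjK addrC.
Qed.

Lemma toeplitz_cumulative al k j :
  toeplitz_entry al k j + \sum_(m < k) toeplitz_entry al m j
    + \sum_(m < j) toeplitz_entry al k m
  = \sum_(l < k.+1) al l + adj (\sum_(l < j.+1) al l).
Proof.
have row0 n : \sum_(m < n.+1) toeplitz_entry al 0 m
    = al 0%N + adj (\sum_(l < n.+1) al l).
  elim: n => [|n IH]; first by rewrite !big_ord1.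
  by rewrite big_ord_recr IH [in RHS]big_ord_recr /= adjD addrA.
have col0 n : \sum_(m < n.+1) toeplitz_entry al m 0
    = \sum_(l < n.+1) al l + adj (al 0%N).
  elim: n => [|n IH]; first by rewrite !big_ord1.
  by rewrite big_ord_recr IH [in RHS]big_ord_recr /= addrAC.
elim: k j => [|k IH] [|j].
- by rewrite !big_ord0 !addr0 !big_ord1.
- by rewrite big_ord0 addr0 addrC -(big_ord_recr j.+1 (fun m => toeplitz_entry al 0 m)) row0 big_ord1.
- by rewrite big_ord0 addr0 addrC -(big_ord_recr k.+1 (fun m => toeplitz_entry al m 0)) col0 big_ord1.
have -> : \sum_(m < k.+1) toeplitz_entry al m j.+1
    = adj (al j.+1) + \sum_(m < k) toeplitz_entry al m j.
  by rewrite big_ord_recl; congr (_ + _); apply: eq_bigr => m _; exact: toeplitz_entryS.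
have -> : \sum_(m < j.+1) toeplitz_entry al k.+1 m
    = al k.+1 + \sum_(m < j) toeplitz_entry al k m.
  by rewrite big_ord_recl; congr (_ + _); apply: eq_bigr => m _; exact: toeplitz_entryS.
rewrite toeplitz_entryS [in RHS]big_ord_recr [X in _ = _ + adj X]big_ord_recr /= adjD.
rewrite [RHS]addrACA -IH.
move: (\sum_(m < k) _) (\sum_(m < j) _) => S1 S2.
by apply/matrixP => x y; rewrite !mxE; ring.
Qed.

Record linked (b : nat -> 'M[C]_(p, p + p)) (al : nat -> 'M[C]_p)
    (X : nat -> nat -> 'M[C]_p) : Prop := Linked {
  linked_admissible : admissible b;
  linked_lower : forall n l, (n < l)%N -> X n l = 0;
  linked_diag : forall n, X n n \in unitmx;
  linked_shift : forall n j, \sum_(m < n) X m j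
    = \sum_(l < n.+1) X n l *m (if (j < l)%N then b l *m J *m adj (b j) else 0);
  linked_rows : forall n,
    \sum_(l < n.+1) X n l *m b l = row_mx 1%:M (\sum_(l < n.+1) al l) }.

Section Consequences.
Variables (b : nat -> 'M[C]_(p, p + p)) (al : nat -> 'M[C]_p).
Variable X : nat -> nat -> 'M[C]_p.
Hypothesis lX : linked b al X.

Let low l j := if (j < l)%N then b l *m J *m adj (b j) else 0.

Lemma linked_gramJ l j : b l *m J *m adj (b j)
  = low l j + adj (low j l) + (if l == j then 1%:M else 0).
Proof.
rewrite /low; case: (ltngtP l j) => [lj|lj|->].
- by rewrite add0r addr0 !adjM adjK adj_Jm mulmxA.
- by rewrite adj0 !addr0.
- by rewrite adj0 !add0r (linked_admissible lX).
Qed.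

Lemma linked_shiftW n j N : (n < N)%N ->
  \sum_(m < n) X m j = \sum_(l < N) X n l *m low l j.
Proof.
move=> nN; rewrite (linked_shift lX).
rewrite (sum_ord_trunc (F := fun l => X n l *m low l j) nN) // => l /andP[nl _].
by rewrite (linked_lower lX) // mul0mx.
Qed.

Lemma linked_rowsW n N : (n < N)%N ->
  \sum_(l < N) X n l *m b l = row_mx 1%:M (\sum_(l < n.+1) al l).
Proof.
move=> nN; rewrite -(linked_rows lX).
rewrite (sum_ord_trunc (F := fun l => X n l *m b l) nN) // => l /andP[nl _].
by rewrite (linked_lower lX) // mul0mx.
Qed.

Lemma row1_gramJ (x y : 'M[C]_p) :
  row_mx 1%:M x *m J *m adj (row_mx 1%:M y) = x + adj y.
Proof.
rewrite /Jm mul_row_block !mulmx0 !mulmx1 add0r addr0 adj_row_mx mul_row_col.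
by rewrite adj1 mulmx1 mul1mx.
Qed.

Lemma linked_toeplitz N k j : (k < N)%N -> (j < N)%N ->
  \sum_(l < N) X k l *m adj (X j l) = toeplitz_entry al k j.
Proof.
pose G k j := \sum_(l < N) X k l *m adj (X j l).
move=> kN jN; apply/eqP; rewrite -subr_eq0; apply/eqP.
apply: (cumulative_eq0 (N := N) (D := fun k j => G k j - toeplitz_entry al k j)) => //.
move=> {k j kN jN} k j kN jN; rewrite !sumrB !addrA.
have e1 : \sum_(m < k) G m j
    = \sum_(l < N) \sum_(l' < N) X k l *m low l l' *m adj (X j l').
  rewrite exchange_big [RHS]exchange_big /=; apply: eq_bigr => l _.
  by rewrite -!mulmx_suml (linked_shiftW _ kN).
have e2 : \sum_(m < j) G k m
    = \sum_(l < N) \sum_(l' < N) X k l *m adj (low l' l) *m adj (X j l').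
  rewrite exchange_big /=; apply: eq_bigr => l _.
  rewrite -mulmx_sumr -adj_sum (linked_shiftW _ jN) adj_sum mulmx_sumr.
  by apply: eq_bigr => l' _; rewrite adjM mulmxA.
have e3 : G k j = \sum_(l < N) \sum_(l' < N)
    X k l *m (if l == l' :> nat then 1%:M else 0) *m adj (X j l').
  apply: eq_bigr => l _; rewrite (bigD1 l) //= eqxx mulmx1 big1 ?addr0 // => l' nl.
  by rewrite eq_sym val_eqE (negPf nl) mulmx0 mul0mx.
have eG : G k j + \sum_(m < k) G m j + \sum_(m < j) G k m
    = \sum_(l < k.+1) al l + adj (\sum_(l < j.+1) al l).
  rewrite -row1_gramJ -(linked_rowsW kN) -(linked_rowsW jN) adj_sum.
  rewrite e1 e2 e3 -!big_split /= mulmx_suml mulmx_suml; apply: eq_bigr => l _.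
  rewrite -!big_split /= mulmx_sumr; apply: eq_bigr => l' _.
  have -> : X k l *m b l *m J *m adj (X j l' *m b l')
      = X k l *m (b l *m J *m adj (b l')) *m adj (X j l') by rewrite adjM !mulmxA.
  rewrite linked_gramJ !mulmxDr !mulmxDl.
  by rewrite [RHS]addrC [RHS]addrA.
move: eG; rewrite -(toeplitz_cumulative al k j).
move: (\sum_(m < k) _) (\sum_(m < j) _) (\sum_(m < k) _) (\sum_(m < j) _).
move=> S1 S2 S3 S4 /eqP; rewrite -subr_eq0 => /eqP <-.
by apply/matrixP => x y; rewrite !mxE; ring.
Qed.

End Consequences.
End Linked.

Lemma sum_scaled_diff (K : pzRingType) (V : lmodType K) (z : K) (Y : nat -> V) M :
  \sum_(j < M.+1) z ^+ j *: Y j - z *: \sum_(j < M) z ^+ j *: Y j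
  = Y 0%N + \sum_(j < M) z ^+ j.+1 *: (Y j.+1 - Y j).
Proof.
rewrite big_ord_recl expr0 scale1r -addrA; congr (_ + _).
rewrite scaler_sumr -sumrB; apply: eq_bigr => j _.
by rewrite scalerA -exprS -scalerBr.
Qed.

Section Resolvent.
Variables (R : realType) (p : nat).
Local Notation C := R[i].
Local Notation J := (Jm R p).
Variables (b : nat -> 'M[C]_(p, p + p)) (al : nat -> 'M[C]_p).
Variable X : nat -> nat -> 'M[C]_p.
Hypothesis lX : linked b al X.
Variable z : C.

Definition psi M k := \sum_(j < M) z ^+ j *: X j k.
Definition chi M k := psi M.+1 k - z *: psi M k.
Definition chi_tail M k := \sum_(k <= l < M.+1) chi M l *m b l.

Lemma psi_eq0 M k : (M <= k)%N -> psi M k = 0.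
Proof.
move=> Mk; rewrite /psi big1 // => j _; have := ltn_ord j => jM.
by rewrite (linked_lower lX) ?scaler0 //; lia.
Qed.

Lemma chi_eq0 M k : (M < k)%N -> chi M k = 0.
Proof. by move=> Mk; rewrite /chi !psi_eq0 ?scaler0 ?subr0 // ltnW. Qed.

Lemma chi_sum q (f : nat -> 'M[C]_(p, q)) M :
  \sum_(l < M.+1) chi M l *m f l
  = X 0 0 *m f 0%N + \sum_(j < M) z ^+ j.+1 *:
      (\sum_(l < M.+1) X j.+1 l *m f l - \sum_(l < M.+1) X j l *m f l).
Proof.
have psi_sum N : \sum_(l < M.+1) psi N l *m f l
    = \sum_(j < N) z ^+ j *: \sum_(l < M.+1) X j l *m f l.
  under eq_bigr do rewrite mulmx_suml.
  rewrite exchange_big; apply: eq_bigr => j _.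
  by rewrite scaler_sumr; apply: eq_bigr => l _; rewrite scalemxAl.
under eq_bigr do rewrite mulmxBl -scalemxAl.
rewrite sumrB -scaler_sumr !psi_sum.
rewrite (sum_scaled_diff z (fun j => \sum_(l < M.+1) X j l *m f l)); congr (_ + _).
rewrite big_ord_recl big1 ?addr0 // => l _.
by rewrite (linked_lower lX) ?mul0mx.
Qed.

Lemma chi_tail0 M :
  chi_tail M 0 = row_mx 1%:M (al 0%N + \sum_(j < M) z ^+ j.+1 *: al j.+1).
Proof.
rewrite /chi_tail big_mkord chi_sum.
have := linked_rows lX 0; rewrite !big_ord1 => ->.
under eq_bigr => j _.
  rewrite (linked_rowsW lX (n := j.+1)) ?ltnS // (linked_rowsW lX (n := j)); last first.
    by rewrite ltnS ltnW.
  rewrite opp_row_mx add_row_mx subrr [in row_mx _ _]big_ord_recr /= addrAC subrr add0r.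
  rewrite scale_row_mx scaler0; over.
rewrite [X in _ + X](_ : _ = row_mx 0 (\sum_(j < M) z ^+ j.+1 *: al j.+1)).
  by rewrite add_row_mx addr0.
elim/big_rec2 : _ => [|j x y _ ->]; first by rewrite row_mx0.
by rewrite add_row_mx addr0.
Qed.

Lemma chi_low M k :
  \sum_(l < M.+1) chi M l *m (if (k < l)%N then b l *m J *m adj (b k) else 0)
  = z *: psi M k.
Proof.
rewrite (chi_sum (fun l => if (k < l)%N then b l *m J *m adj (b k) else 0)).
rewrite ltn0 mulmx0 add0r /psi scaler_sumr; apply: eq_bigr => j _.
rewrite -!(linked_shiftW lX) ?ltnS // ?(ltnW (ltn_ord j)) //.
by rewrite big_ord_recr /= addrAC subrr add0r scalerA -exprS.
Qed.

Lemma chi_tail_gt M k : (M < k)%N -> chi_tail M k = 0.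
Proof. by move=> Mk; rewrite /chi_tail big_geq. Qed.

Lemma chi_tailS M k : chi_tail M k.+1 = chi_tail M k - chi M k *m b k.
Proof.
have [kM|Mk] := leqP k M.
  by rewrite /chi_tail [in RHS]big_ltn ?ltnS // addrAC subrr add0r.
by rewrite chi_eq0 // mul0mx subr0 !chi_tail_gt // ltnW.
Qed.

Lemma chi_tail_J M k : chi_tail M k *m J *m adj (b k) = psi M.+1 k.
Proof.
have [kM|Mk] := leqP k M; last first.
  by rewrite chi_tail_gt // !mul0mx psi_eq0.
rewrite /chi_tail big_ltn ?ltnS // mulmxDl mulmxDl -!mulmxA (mulmxA (b k)).
rewrite (linked_admissible lX) mulmx1 /chi.
rewrite -[LHS]addrA -[RHS]addr0; congr (_ + _).
rewrite !mulmx_suml -(chi_low M k).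
rewrite -(big_mkord xpredT
  (fun l => chi M l *m (if (k < l)%N then b l *m J *m adj (b k) else 0))).
rewrite (big_cat_nat (n := k.+1)) //= big_nat [X in - (X + _)]big1 ?add0r.
  apply/eqP; rewrite addrC subr_eq0; apply/eqP; apply: eq_big_nat => l /andP[kl _].
  by rewrite kl -!mulmxA.
by move=> l /andP[_ lk]; rewrite ltnNge -ltnS lk mulmx0.
Qed.

Lemma chi_tail_norm_step M k :
  chi_tail M k *m J *m adj (chi_tail M k)
  = chi_tail M k.+1 *m J *m adj (chi_tail M k.+1)
    + (psi M.+1 k *m adj (psi M.+1 k) - (z * z^*) *: (psi M k *m adj (psi M k))).
Proof.
have e1 := chi_tail_J M k.
have e2 : b k *m J *m adj (chi_tail M k) = adj (psi M.+1 k).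
  by rewrite -e1 !adjM adjK adj_Jm mulmxA.
have ec : chi M k = psi M.+1 k - z *: psi M k by [].
rewrite chi_tailS; move: (chi_tail M k) (chi M k) e1 e2 ec => r c e1 e2 ec.
have -> : (r - c *m b k) *m J *m adj (r - c *m b k)
    = r *m J *m adj r - psi M.+1 k *m adj c - c *m adj (psi M.+1 k) + c *m adj c.
  have e3 : c *m b k *m J *m adj r = c *m adj (psi M.+1 k) by rewrite -e2 !mulmxA.
  have e4 : c *m b k *m J *m adj (b k) = c.
    by rewrite -[RHS]mulmx1 -(linked_admissible lX k) !mulmxA.
  rewrite adjB adjM !(mulmxBl, mulmxBr) !mulmxA e1 e3 e4.
  move: (r *m J *m adj r) (psi M.+1 k *m adj c) (c *m adj c) (c *m _) => A B D E.
  by apply/matrixP => x y; rewrite !mxE; ring.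
rewrite ec adjB adjZ !(mulmxBl, mulmxBr) -!scalemxAl -!scalemxAr.
move: (r *m J *m adj r) (psi M.+1 k *m adj _) (psi M k *m adj (psi M k)) => A B D.
move: (psi M k *m adj _) (psi M.+1 k *m adj _) => E F.
by apply/matrixP => x y; rewrite !mxE; ring.
Qed.

Definition psi_energy n M N := \sum_(n <= k < N) psi M k *m adj (psi M k).

Lemma chi_tail_norm M n :
  chi_tail M n *m J *m adj (chi_tail M n)
  = psi_energy n M.+1 M.+1 - (z * z^*) *: psi_energy n M M.
Proof.
rewrite /psi_energy.
have -> : \sum_(n <= k < M) psi M k *m adj (psi M k)
    = \sum_(n <= k < M.+1) psi M k *m adj (psi M k).
  have [nM|Mn] := leqP n M; last by rewrite !big_geq // ltnW.
  by rewrite [RHS]big_nat_recr //= psi_eq0 // mul0mx addr0.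
have [nM|Mn] := leqP n M.+1; last first.
  by rewrite chi_tail_gt 1?ltnW // !mul0mx !big_geq ?scaler0 ?subr0 // ltnW.
have [d] := ubnP (M.+1 - n); elim: d n nM => // d IH n nM; rewrite ltnS => dn.
case: (ltngtP n M.+1) nM => [nM _|//|-> _]; last first.
  by rewrite chi_tail_gt // !mul0mx !big_geq ?scaler0 ?subr0.
rewrite chi_tail_norm_step IH //; last lia.
rewrite ![in RHS](@big_ltn _ _ _ n) //.
move: (\sum_(_ <= _ < _) _) (\sum_(_ <= _ < _) _) => A B.
move: (psi M.+1 n *m _) (psi M n *m _) => D E.
by apply/matrixP => x y; rewrite !mxE; ring.
Qed.

Lemma psi_energy_ge0 n M N v : 0 <= hform (psi_energy n M N) v.
Proof.
rewrite hform_sum; apply: sumr_ge0 => k _.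
by rewrite -{1}[psi M k]adjK hform_gram_ge0.
Qed.

End Resolvent.

Lemma nat_dependent_choice (V : Type) (v0 : V) (P : nat -> (nat -> V) -> V -> Prop) :
  (forall n f g, (forall m, (m < n)%N -> f m = g m) ->
     forall v, P n f v -> P n g v) ->
  (forall n f, (forall m, (m < n)%N -> P m f (f m)) -> exists v, P n f v) ->
  exists f, forall n, P n f (f n).
Proof.
move=> Pext Pex.
pose next n f : V := match pselect (exists v, P n f v) with
  | left h => sval (cid h) | right _ => v0 end.
have nextP n f : (exists v, P n f v) -> P n f (next n f).
  by rewrite /next; case: pselect => // h _; exact: (svalP (cid h)).
pose fix g n : nat -> V :=
  if n is n'.+1 then fun m => if m == n' then next n' (g n') else g n' m
  else fun _ => v0.
have g_stable n d m : (m < n)%N -> g (n + d)%N m = g n m.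
  move=> mn; elim: d => [|d IH]; first by rewrite addn0.
  by rewrite addnS /= ifN_eq ?IH // ltn_eqF // (leq_trans mn) // leq_addr.
pose f m := g m.+1 m.
have gf n m : (m < n)%N -> g n m = f m.
  by move=> mn; rewrite /f -(subnKC mn) g_stable.
exists f => n; have [k] := ubnP n; elim: k n => // k IH n; rewrite ltnS => nk.
have : P n (g n) (next n (g n)).
  apply/nextP/Pex => m mn; rewrite gf //.
  apply: (Pext m f); last by apply: IH; exact: leq_trans mn nk.
  by move=> i im; rewrite gf //; exact: ltn_trans im mn.
rewrite [X in P n f X](_ : f n = next n (g n)); last by rewrite /f /= eqxx.
by apply: Pext => m mn; exact: gf.
Qed.

Section Triangular.
Variables (K : comUnitRingType) (p : nat).

Lemma backward_solve q (M : nat -> nat -> 'M[K]_p) (Y : nat -> 'M[K]_(q, p)) n :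
  (forall l j, (l < j)%N -> M l j = 0) ->
  (forall j, (j < n)%N -> M j j \in unitmx) ->
  exists x : nat -> 'M[K]_(q, p),
    [/\ forall l, (n <= l)%N -> x l = 0,
        forall j, (j < n)%N -> \sum_(l < n) x l *m M l j = Y j
      & forall k, n = k.+1 -> x k = Y k *m invmx (M k k)].
Proof.
move=> M0; elim: n Y => [|n IH] Y Mu; first by exists (fun=> 0).
have [|x [x0 xP _]] := IH (fun j => Y j - Y n *m invmx (M n n) *m M n j).
  by move=> j jn; apply: Mu; exact: ltnW.
exists (fun l => if l == n then Y n *m invmx (M n n) else x l); split.
- by move=> l nl; rewrite gtn_eqF // x0 // ltnW.
- move=> j; rewrite ltnS => jn.
  rewrite big_ord_recr /= eqxx.
  under eq_bigr => l _ do rewrite ltn_eqF //.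
  case: (ltngtP j n) jn => [jn _|//|-> _]; first by rewrite xP // subrK.
  rewrite big1 ?add0r ?mulmxKV ?Mu // => l _.
  by rewrite M0 ?mulmx0.
- by move=> k [<-]; rewrite eqxx.
Qed.

Lemma forward_solve q (X : nat -> nat -> 'M[K]_p) (Y : nat -> 'M[K]_(p, q)) n :
  (forall j, (j < n)%N -> X j j \in unitmx) ->
  exists y : nat -> 'M[K]_(p, q),
    forall j, (j < n)%N -> \sum_(l < j.+1) X j l *m y l = Y j.
Proof.
move=> Xu.
pose P j (y : nat -> 'M[K]_(p, q)) v :=
  (j < n)%N -> \sum_(l < j) X j l *m y l + X j j *m v = Y j.
have [j f g fg v|j f _|y yP] := @nat_dependent_choice _ 0 P.
- by rewrite /P => h /h <-; congr (_ + _); apply: eq_bigr => l _; rewrite fg.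
- exists (invmx (X j j) *m (Y j - \sum_(l < j) X j l *m f l)) => /Xu u.
  by rewrite mulKVmx // addrC subrK.
- by exists y => j jn; rewrite big_ord_recr; exact: yP.
Qed.

Lemma triangular_cancel q (X : nat -> nat -> 'M[K]_p) (E : nat -> 'M[K]_(p, q)) n :
  (forall k l, (k < l)%N -> X k l = 0) ->
  (forall k, (k < n)%N -> X k k \in unitmx) ->
  (forall k, (k < n)%N -> \sum_(l < n) X k l *m E l = 0) ->
  forall k, (k < n)%N -> E k = 0.
Proof.
move=> X0 Xu h k; have [m] := ubnP k; elim: m k => // m IH k km kn.
have := h k kn; rewrite (sum_ord_trunc (F := fun l => X k l *m E l) kn); last first.
  by move=> l /andP[kl _]; rewrite X0 // mul0mx.
rewrite big_ord_recr big1 /= ?add0r => [e|l _].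
  by rewrite -[E k](mulKmx (Xu k kn)) e mulmx0.
by rewrite IH ?mulmx0 //; [have := ltn_ord l; lia | exact: ltn_trans kn].
Qed.

End Triangular.

Section Existence.
Variables (R : realType) (p : nat).
Local Notation C := R[i].
Local Notation J := (Jm R p).

Lemma linked_of_admissible (b : nat -> 'M[C]_(p, p + p)) :
  admissible b -> exists al X, linked b al X.
Proof.
move=> adm.
pose M l j := if j is j'.+1 then
    (if (j' < l)%N then b l *m J *m adj (b j') else 0) else lsubmx (b l).
have M0 l j : (l < j)%N -> M l j = 0.
  by case: j => // j; rewrite ltnS /M => lj; rewrite ltnNge lj.
have Mu j : M j j \in unitmx.
  case: j => [|j] /=; first exact: normalized_row_lsub_unit.
  by rewrite ltnSn; exact: normalized_rows_unit.
pose Y (X : nat -> nat -> 'M[C]_p) n j : 'M[C]_p :=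
  if j is j'.+1 then \sum_(m < n) X m j' else 1%:M.
pose P n X (x : nat -> 'M[C]_p) :=
  [/\ forall l, (n < l)%N -> x l = 0,
      forall j, (j < n.+1)%N -> \sum_(l < n.+1) x l *m M l j = Y X n j
    & x n = Y X n n *m invmx (M n n)].
have [n f g fg v|n f _|X XP] := @nat_dependent_choice _ (fun=> 0) P.
- have e j : Y f n j = Y g n j.
    by case: j => //= j; apply: eq_bigr => m _; rewrite fg.
  by move=> [v0 vP vn]; split=> // [j|]; rewrite -e //; exact: vP.
- have [x [x0 xP xn]] := backward_solve (Y f n) M0 (fun j _ => Mu j) (n := n.+1).
  by exists x; split=> //; exact: xn.
have X0 n l : (n < l)%N -> X n l = 0 by have [h _ _] := XP n; exact: h.
have Xu n : X n n \in unitmx.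
  elim: n => [|n IH]; first by have [_ _ ->] := XP 0%N; rewrite mul1mx unitmx_inv Mu.
  have [_ _ ->] := XP n.+1.
  rewrite unitmx_mul unitmx_inv Mu andbT /Y big_ord_recr big1 /= ?add0r // => m _.
  exact: X0.
pose sg n := \sum_(l < n.+1) X n l *m rsubmx (b l).
pose al n := if n is n'.+1 then sg n - sg n' else sg 0%N.
have al_sum n : \sum_(l < n.+1) al l = sg n.
  elim: n => [|n IH]; first by rewrite big_ord1.
  by rewrite big_ord_recr IH /= addrC subrK.
exists al, X; split=> //.
- move=> n j; have [jn|nj] := ltnP j n.
    by have [_ h _] := XP n; have /= <- := h j.+1 jn.
  rewrite [LHS]big1 => [|l _]; last by apply: X0; exact: leq_trans nj.
  rewrite big1 // => l _; rewrite ltnNge (leq_trans _ nj) ?mulmx0 //.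
  by rewrite -ltnS.
- move=> n; rewrite al_sum -[LHS]hsubmxK; congr row_mx.
    rewrite -[LHS]mulmx1 -[RHS](_ : \sum_(l < n.+1) X n l *m M l 0%N = _); last first.
      by have [_ h _] := XP n; rewrite h.
    rewrite mulmx1; elim/big_rec2 : _ => [|l x y _ <-]; first by rewrite linear0.
    by rewrite linearD /= -mulmx_lsub.
  rewrite /sg; elim/big_rec2 : _ => [|l x y _ <-]; first by rewrite linear0.
  by rewrite linearD /= -mulmx_rsub.
Qed.

Lemma posdef_factor n (S : 'M[C]_n) :
  posdef S -> exists2 D : 'M[C]_n, D \in unitmx & D *m adj D = S.
Proof.
move=> [Sh Sp].
have adjt m k (A : 'M[C]_(m, k)) : map_mx Num.conj A^T = adj A by rewrite /adj map_trmx.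
have /orthomx_spectralP : S \is normalmx by apply/normalmxP; rewrite adjt Sh.
have /unitarymxP := spectral_unitarymx S.
have := spectral_unit S; move: (spectralmx S) (spectral_diag S) => P d Pu.
rewrite adjt => PP SE.
have Pi : invmx P = adj P by rewrite -[LHS]mulmx1 -PP mulKmx.
have PSP : P *m S *m adj P = diag_mx d.
  by rewrite SE Pi !mulmxA PP mul1mx -mulmxA PP mulmx1.
have d_gt0 i : 0 < d 0 i.
  have <- : hform S (adj (row i P)) = d 0 i.
    rewrite /hform adjK -row_mul -[RHS](mulr1n _).
    have /matrixP/(_ i i) := PSP; rewrite !mxE eqxx => <-.
    by apply: eq_bigr => j _; rewrite !mxE.
  apply: Sp; apply/eqP => /(congr1 (@adj R _ _)); rewrite adjK adj0 => Pi0.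
  have /matrixP/(_ i i) := PP; rewrite !mxE eqxx big1 => [/eqP|j _].
    by rewrite eq_sym oner_eq0.
  by have /matrixP/(_ 0 j) := Pi0; rewrite !mxE => ->; rewrite mul0r.
pose D := adj P *m diag_mx (\row_i sqrtC (d 0 i)).
have DD : D *m adj D = S.
  rewrite /D adjM adjK mulmxA -(mulmxA (adj P)) SE Pi.
  suff -> : diag_mx (\row_i sqrtC (d 0 i)) *m adj (diag_mx (\row_i sqrtC (d 0 i)))
    = diag_mx d by [].
  have -> : adj (diag_mx (\row_i sqrtC (d 0 i))) = diag_mx (\row_i sqrtC (d 0 i)).
    apply/matrixP => i j; rewrite adjE !mxE eq_sym.
    case: eqP => [->|_]; rewrite ?mulr1n ?mulr0n ?rmorph0 //.
    by apply: CrealP; rewrite ger0_real // sqrtC_ge0 ltW.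
  rewrite mulmx_diag; congr diag_mx; apply/matrixP => i j.
  by rewrite ord1 !mxE -expr2 sqrtCK.
exists D => //; rewrite -unitmx_adj; apply: unitmx_kernel => v Dv.
apply/eqP/negP => /negP/Sp.
by rewrite -DD -(mulmxA _ _ v) -(mulmxA D) Dv !mulmx0 mxE ltxx.
Qed.

Definition toeplitz_positive (al : nat -> 'M[C]_p) :=
  forall n (y : nat -> 'rV[C]_p) k, (k < n)%N -> y k != 0 ->
    0 < (\sum_(k < n) \sum_(j < n)
           y k *m toeplitz_entry al k j *m adj (y j)) 0 0.

Lemma hermitian_gram_entries (T X : nat -> nat -> 'M[C]_p) N :
  (forall k j, adj (T k j) = T j k) ->
  (forall k l, (k < N)%N -> (k < l)%N -> X k l = 0) ->
  (forall k j, (k < N)%N -> (j <= k)%N ->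
     \sum_(l < k.+1) X k l *m adj (X j l) = T k j) ->
  forall k j, (k < N)%N -> (j < N)%N ->
    \sum_(l < N) X k l *m adj (X j l) = T k j.
Proof.
move=> Th X0 XP.
have h k j : (k < N)%N -> (j <= k)%N -> \sum_(l < N) X k l *m adj (X j l) = T k j.
  move=> kN jk; rewrite (sum_ord_trunc (F := fun l => X k l *m adj (X j l)) kN) ?XP //.
  by move=> l /andP[kl _]; rewrite X0 // mul0mx.
move=> k j kN jN; have [jk|/ltnW kj] := leqP j k; first exact: h.
rewrite -Th -(h _ _ jN kj) adj_sum; apply: eq_bigr => l _.
by rewrite adjM adjK.
Qed.

Section SchurComplement.
Variables (al : nat -> 'M[C]_p) (f : nat -> nat -> 'M[C]_p) (n : nat).
Hypothesis alP : toeplitz_positive al.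
Hypothesis f0 : forall k l, (k < n)%N -> (k < l)%N -> f k l = 0.
Hypothesis fu : forall k, (k < n)%N -> f k k \in unitmx.
Hypothesis fT : forall k j, (k < n)%N -> (j < n)%N ->
  \sum_(l < n) f k l *m adj (f j l) = toeplitz_entry al k j.
Variable y : nat -> 'M[C]_p.
Hypothesis yP : forall k, (k < n)%N ->
  \sum_(l < n) f k l *m y l = toeplitz_entry al k n.

Let Delta := toeplitz_entry al n n - \sum_(l < n) adj (y l) *m y l.

Lemma schur_complement_posdef : posdef Delta.
Proof.
split.
  rewrite /Delta adjB toeplitz_entry_adj adj_sum.
  by congr (_ - _); apply: eq_bigr => l _; rewrite adjM adjK.
move=> v v0.
pose f' k l := if (k < n)%N then f k l else 0.
have [w [_ wP _]] : exists w : nat -> 'rV[C]_p,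
    [/\ forall l, (n <= l)%N -> w l = 0,
        forall l, (l < n)%N -> \sum_(k < n) w k *m f' k l = - (adj v *m adj (y l))
      & forall k, n = k.+1 -> w k = - (adj v *m adj (y k)) *m invmx (f' k k)].
  apply: (backward_solve (fun l => - (adj v *m adj (y l)))).
    by move=> k l kl; rewrite /f'; case: ifP => // kn; exact: f0.
  by move=> k kn; rewrite /f' kn; exact: fu.
pose g k l := if (k < n)%N then f k l else adj (y l).
pose z k := if (k < n)%N then w k else adj v.
have zg l : (l < n)%N -> \sum_(k < n.+1) z k *m g k l = 0.
  move=> ln; rewrite big_ord_recr /= {2}/z {2}/g ltnn.
  rewrite (eq_bigr (fun k : 'I_n => w k *m f' k l)) ?wP ?addNr // => k _.
  by rewrite /z /g /f' ltn_ord.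
have gT k j : (k < n.+1)%N -> (j < n.+1)%N -> toeplitz_entry al k j
    = \sum_(l < n) g k l *m adj (g j l) + (if (k == n) && (j == n) then Delta else 0).
  rewrite !ltnS /g; case: (ltngtP k n) => // [kn|->] _; case: (ltngtP j n) => // [jn|->] _.
  - by rewrite fT ?addr0.
  - by rewrite addr0 -(yP kn); apply: eq_bigr => l _; rewrite adjK.
  - rewrite addr0 -toeplitz_entry_adj -(yP jn) adj_sum.
    by apply: eq_bigr => l _; rewrite adjM.
  - by rewrite /Delta; under eq_bigr do rewrite adjK; rewrite addrC subrK.
have zn : z n != 0.
  rewrite /z ltnn; apply: contra_neq v0 => h.
  by rewrite -[v]adjK h adj0.
have := alP (ltnSn n) zn.
suff -> : \sum_(k < n.+1) \sum_(j < n.+1) z k *m toeplitz_entry al k j *m adj (z j)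
  = adj v *m Delta *m v by [].
have -> : \sum_(k < n.+1) \sum_(j < n.+1) z k *m toeplitz_entry al k j *m adj (z j)
  = \sum_(k < n.+1) \sum_(j < n.+1) \sum_(l < n) (z k *m g k l) *m adj (z j *m g j l)
    + \sum_(k < n.+1) \sum_(j < n.+1) (if (k == n :> nat) && (j == n :> nat)
        then z k *m Delta *m adj (z j) else 0).
  rewrite -big_split; apply: eq_bigr => k _ /=.
  rewrite -big_split; apply: eq_bigr => j _ /=.
  rewrite gT // mulmxDr mulmxDl mulmx_sumr mulmx_suml; congr (_ + _).
    by apply: eq_bigr => l _; rewrite adjM !mulmxA.
  by case: ifP => // _; rewrite mulmx0 mul0mx.
rewrite [X in X + _]big1 ?add0r => [|k _].
  rewrite big_ord_recr big1 /= ?add0r => [|k _].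
    rewrite big_ord_recr big1 /= ?add0r => [|j _].
      by rewrite eqxx /z ltnn adjK.
    by rewrite eqxx ltn_eqF.
  by rewrite big1 // => j _; rewrite ltn_eqF.
rewrite exchange_big big1 //= => l _.
rewrite -mulmx_sumr -adj_sum zg ?ltn_ord //.
by rewrite adj0 mulmx0.
Qed.

End SchurComplement.

Lemma toeplitz_cholesky al : toeplitz_positive al -> exists X : nat -> nat -> 'M[C]_p,
  [/\ forall n l, (n < l)%N -> X n l = 0, forall n, X n n \in unitmx
    & forall N k j, (k < N)%N -> (j < N)%N ->
        \sum_(l < N) X k l *m adj (X j l) = toeplitz_entry al k j].
Proof.
move=> alP; pose T := toeplitz_entry al.
have Th k j : adj (T k j) = T j k by exact: toeplitz_entry_adj.
pose P n (X : nat -> nat -> 'M[C]_p) (x : nat -> 'M[C]_p) :=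
  [/\ forall l, (n < l)%N -> x l = 0, x n \in unitmx,
      forall j, (j < n)%N -> \sum_(l < n.+1) x l *m adj (X j l) = T n j
    & \sum_(l < n.+1) x l *m adj (x l) = T n n].
have PT N X : (forall m, (m < N)%N -> P m X (X m)) ->
    forall k j, (k < N)%N -> (j < N)%N -> \sum_(l < N) X k l *m adj (X j l) = T k j.
  move=> XP; apply: hermitian_gram_entries => // [k l kN kl|k j kN].
    by have [h _ _ _] := XP k kN; exact: h.
  have [_ _ h1 h2] := XP k kN; rewrite leq_eqVlt => /orP[/eqP-> //|].
  exact: h1.
have [n f g fg v|n f fP|X XP] := @nat_dependent_choice _ (fun=> 0) P.
- move=> [v0 vu vP vn]; split=> // j jn; rewrite -vP //.
  by apply: eq_bigr => l _; rewrite fg.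
- have f0 k l : (k < n)%N -> (k < l)%N -> f k l = 0.
    by move=> kn kl; have [h _ _ _] := fP k kn; exact: h.
  have fu k : (k < n)%N -> f k k \in unitmx by move=> kn; have [] := fP k kn.
  have [y yP] := forward_solve (fun k => T k n) fu.
  have {}yP k : (k < n)%N -> \sum_(l < n) f k l *m y l = T k n.
    move=> kn; rewrite -yP // (sum_ord_trunc (F := fun l => f k l *m y l) kn) //.
    by move=> l /andP[kl _]; rewrite f0 // mul0mx.
  have [D Du DD] := posdef_factor (schur_complement_posdef alP f0 fu (PT n f fP) yP).
  exists (fun l => if (l < n)%N then adj (y l) else if l == n then D else 0); split.
  + by move=> l nl; rewrite ltnNge ltnW // gtn_eqF.
  + by rewrite ltnn eqxx.
  + move=> j jn; rewrite big_ord_recr /= (f0 j n) // adj0 mulmx0 addr0.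
    rewrite -Th -yP // adj_sum; apply: eq_bigr => l _.
    by rewrite ltn_ord adjM.
  + rewrite big_ord_recr /= ltnn eqxx DD addrC -[RHS](subrK (\sum_(l < n) adj (y l) *m y l)).
    by congr (_ + _); apply: eq_bigr => l _; rewrite ltn_ord adjK.
exists X; split.
- by move=> n l nl; have [h _ _ _] := XP n; exact: h.
- by move=> n; have [] := XP n.
- by move=> N; apply: PT => m _.
Qed.

Lemma linked_of_toeplitz al : toeplitz_positive al -> exists b X, linked b al X.
Proof.
move=> /toeplitz_cholesky[X [X0 Xu XT]].
pose sg n := \sum_(l < n.+1) al l.
have [b bP] : exists b : nat -> 'M[C]_(p, p + p),
    forall n, \sum_(l < n.+1) X n l *m b l = row_mx 1%:M (sg n).
  pose P n (b : nat -> 'M[C]_(p, p + p)) v :=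
    \sum_(l < n) X n l *m b l + X n n *m v = row_mx 1%:M (sg n).
  have [n f g fg v|n f _|b bP] := @nat_dependent_choice _ 0 P.
  - by rewrite /P => <-; congr (_ + _); apply: eq_bigr => l _; rewrite fg.
  - exists (invmx (X n n) *m (row_mx 1%:M (sg n) - \sum_(l < n) X n l *m f l)).
    by rewrite /P mulKVmx // addrC subrK.
  - by exists b => n; rewrite big_ord_recr; exact: bP.
have [A AP] : exists A : nat -> nat -> 'M[C]_p,
    forall n j, \sum_(l < n.+1) X n l *m A l j = \sum_(m < n) X m j.
  pose P n (A : nat -> nat -> 'M[C]_p) v :=
    forall j, \sum_(l < n) X n l *m A l j + X n n *m v j = \sum_(m < n) X m j.
  have [n f g fg v h j|n f _|A AP] := @nat_dependent_choice _ (fun=> 0) P.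
  - by rewrite -h; congr (_ + _); apply: eq_bigr => l _; rewrite fg.
  - exists (fun j => invmx (X n n) *m (\sum_(m < n) X m j - \sum_(l < n) X n l *m f l j)).
    by move=> j; rewrite mulKVmx // addrC subrK.
  - by exists A => n j; rewrite big_ord_recr; exact: AP.
have widen q (f : nat -> 'M[C]_(p, q)) n N : (n < N)%N ->
    \sum_(l < N) X n l *m f l = \sum_(l < n.+1) X n l *m f l.
  move=> nN; apply: (sum_ord_trunc (F := fun l => X n l *m f l) nN) => l /andP[nl _].
  by rewrite X0 // mul0mx.
have A0 l j : (l <= j)%N -> A l j = 0.
  move=> lj; apply: (triangular_cancel (X := X) (E := A^~ j) (n := l.+1)) => //.
  move=> k kl; rewrite (widen _ (fun l => A l j)) // AP big1 // => m _.
  by apply: X0; have := ltn_ord m; lia.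
have bA k j : b k *m J *m adj (b j) = A k j + adj (A j k)
    + (if k == j then 1%:M else 0).
  pose E k j := b k *m J *m adj (b j) - (A k j + adj (A j k)
    + (if k == j then 1%:M else 0)).
  apply/eqP; rewrite -subr_eq0 -/(E k j); apply/eqP.
  have XE N k' j' : (k' < N)%N -> (j' < N)%N ->
      \sum_(l < N) X k' l *m \sum_(l' < N) E l l' *m adj (X j' l') = 0.
    move=> {k j}k'N j'N; move: k' j' k'N j'N => k j kN jN.
    have -> : \sum_(l < N) X k l *m \sum_(l' < N) E l l' *m adj (X j l')
        = (\sum_(l < N) X k l *m b l) *m J *m adj (\sum_(l < N) X j l *m b l)
          - (\sum_(l' < N) (\sum_(l < N) X k l *m A l l') *m adj (X j l')
            + \sum_(l < N) X k l *m adj (\sum_(l' < N) X j l' *m A l' l)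
            + \sum_(l < N) X k l *m adj (X j l)).
      have -> : \sum_(l' < N) (\sum_(l < N) X k l *m A l l') *m adj (X j l')
          = \sum_(l < N) \sum_(l' < N) X k l *m A l l' *m adj (X j l').
        by under eq_bigr do rewrite mulmx_suml; rewrite exchange_big.
      rewrite -!big_split /=.
      rewrite !mulmx_suml -sumrB; apply: eq_bigr => l _.
      rewrite !adj_sum !mulmx_sumr.
      have -> : X k l *m adj (X j l) = \sum_(l' < N)
          X k l *m (if l == l' :> nat then 1%:M else 0) *m adj (X j l').
        rewrite (bigD1 l) //= eqxx mulmx1 big1 ?addr0 // => l' nl.
        by rewrite eq_sym val_eqE (negPf nl) mulmx0 mul0mx.
      rewrite -!big_split /= -sumrB; apply: eq_bigr => l' _.
      rewrite /E [adj (X j l' *m b l')]adjM [adj (X j l' *m A l' l)]adjM.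
      by rewrite mulmxBl mulmxBr !mulmxDl !mulmxDr !mulmxA.
    have -> : \sum_(l' < N) (\sum_(l < N) X k l *m A l l') *m adj (X j l')
        = \sum_(m < k) toeplitz_entry al m j.
      transitivity (\sum_(l' < N) \sum_(m < k) X m l' *m adj (X j l')).
        apply: eq_bigr => l' _.
        by rewrite (widen _ (fun l => A l l')) // AP mulmx_suml.
      rewrite exchange_big; apply: eq_bigr => m _.
      by rewrite XT // (ltn_trans (ltn_ord m)).
    have -> : \sum_(l < N) X k l *m adj (\sum_(l' < N) X j l' *m A l' l)
        = \sum_(m < j) toeplitz_entry al k m.
      transitivity (\sum_(l < N) \sum_(m < j) X k l *m adj (X m l)).
        apply: eq_bigr => l _.
        by rewrite (widen _ (fun l' => A l' l)) // AP adj_sum mulmx_sumr.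
      rewrite exchange_big; apply: eq_bigr => m _.
      by rewrite XT // (ltn_trans (ltn_ord m)).
    rewrite !widen // !bP row1_gramJ -toeplitz_cumulative XT //.
    by apply/eqP; rewrite subr_eq0; apply/eqP; rewrite -[LHS]addrA [LHS]addrC.
  pose N := (k + j).+1.
  have kN : (k < N)%N by rewrite /N; lia.
  have jN : (j < N)%N by rewrite /N; lia.
  have EX l j' : (l < N)%N -> (j' < N)%N -> \sum_(l' < N) E l l' *m adj (X j' l') = 0.
    move=> lN j'N; apply: (triangular_cancel (X := X) (n := N)
      (E := fun l => \sum_(l' < N) E l l' *m adj (X j' l'))) => // k' k'N.
    exact: XE.
  apply: adj_inj; rewrite adj0.
  apply: (triangular_cancel (X := X) (n := N) (E := fun l => adj (E k l))) => // j' j'N.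
  have /(congr1 (@adj R p p)) := EX k j' kN j'N; rewrite adj_sum adj0; apply: etrans.
  by apply: eq_bigr => l _; rewrite adjM adjK.
exists b, X; split=> //.
- by move=> k; rewrite bA A0 // adj0 eqxx !add0r.
- move=> n j; rewrite -AP; apply: eq_bigr => l _; congr (_ *m _).
  have [jl|lj] := ltnP j l; last by rewrite A0.
  by rewrite bA (A0 j l (ltnW jl)) adj0 (gtn_eqF jl) !addr0.
Qed.

End Existence.

Section ComplexLimits.
Variable R : realType.
Local Notation C := R[i].

Definition ccvg (u : nat -> C) (l : C) : Prop := (u : nat -> C^o) @ \oo --> (l : C^o).

Lemma ccvg_cst l : ccvg (fun=> l) l.
Proof. exact: cvg_cst. Qed.

Lemma ccvgD u v l m : ccvg u l -> ccvg v m -> ccvg (fun n => u n + v n) (l + m).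
Proof. exact: cvgD. Qed.

Lemma ccvgM u v l m : ccvg u l -> ccvg v m -> ccvg (fun n => u n * v n) (l * m).
Proof. exact: (@cvgM C). Qed.

Lemma ccvgN u l : ccvg u l -> ccvg (fun n => - u n) (- l).
Proof. exact: cvgN. Qed.

Lemma ccvg_sum (I : Type) (r : seq I) (u : I -> nat -> C) l :
  (forall i, ccvg (u i) (l i)) ->
  ccvg (fun n => \sum_(i <- r) u i n) (\sum_(i <- r) l i).
Proof.
move=> h; elim: r => [|i r IH].
  rewrite big_nil (_ : (fun _ => _) = fun=> 0); first exact: ccvg_cst.
  by apply/funext => n; rewrite big_nil.
rewrite big_cons (_ : (fun _ => _) = fun n => u i n + \sum_(j <- r) u j n).
  exact: (ccvgD (h i) IH).
by apply/funext => n; rewrite big_cons.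
Qed.

Lemma ccvg_unique u l m : ccvg u l -> ccvg u m -> l = m.
Proof. exact: (@cvg_unique C^o). Qed.

Lemma ccvg_ext u v l : (forall n, u n = v n) -> ccvg u l -> ccvg v l.
Proof. by move=> /funext ->. Qed.

Lemma ccvgP u l : ccvg u l <->
  (forall e : C, 0 < e -> exists N, forall n, (N <= n)%N -> `|l - u n| < e).
Proof.
split=> [/cvgrPdist_lt h e /h [N _ hN]|h].
  by exists N => n Nn; exact: hN.
by apply/cvgrPdist_lt => e /h [N hN]; exists N.
Qed.

Lemma ccvg_conj u l : ccvg u l -> ccvg (fun n => (u n)^*) l^*.
Proof.
move/ccvgP => h; apply/ccvgP => e /h [N hN]; exists N => n /hN.
by rewrite -rmorphB norm_conjC.
Qed.

Lemma ccvg_shift u l : ccvg u l -> ccvg (fun n => u n.+1) l.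
Proof.
move/ccvgP => h; apply/ccvgP => e /h [N hN]; exists N => n Nn.
by apply: hN; exact: leqW.
Qed.

Lemma ccvg_unshift u l : ccvg (fun n => u n.+1) l -> ccvg u l.
Proof.
move/ccvgP => h; apply/ccvgP => e /h [N hN]; exists N.+1 => -[//|n].
by rewrite ltnS; exact: hN.
Qed.

Lemma ccvg_ge0 u l : (forall n, 0 <= u n) -> ccvg u l -> 0 <= l.
Proof.
move=> u0 ul.
have : ccvg (fun n => `|u n|) `|l| by exact: (@cvg_norm _ C^o).
move=> /(ccvg_ext (v := u)) h.
by rewrite (ccvg_unique ul (h _)) // => n; rewrite ger0_norm.
Qed.

Lemma Re_sum (I : Type) (r : seq I) (u : I -> C) :
  complex.Re (\sum_(i <- r) u i) = \sum_(i <- r) complex.Re (u i).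
Proof. by elim/big_rec2 : _ => // i x y _ <-; case: (u i) y => a b [c d]. Qed.

Lemma Im_sum (I : Type) (r : seq I) (u : I -> C) :
  complex.Im (\sum_(i <- r) u i) = \sum_(i <- r) complex.Im (u i).
Proof. by elim/big_rec2 : _ => // i x y _ <-; case: (u i) y => a b [c d]. Qed.

Lemma Re_norm_le (x : C) : (`|complex.Re x|%:C)%C <= `|x|.
Proof. exact: normc_ge_Re. Qed.

Lemma Im_norm_le (x : C) : (`|complex.Im x|%:C)%C <= `|x|.
Proof.
case: x => a b; rewrite normc_def /= lecR -sqrtr_sqr ler_sqrt ?lerDr ?sqr_ge0 //.
by rewrite addr_ge0 ?sqr_ge0.
Qed.

Lemma norm_Re_Im_le (x : C) : `|x| <= ((`|complex.Re x| + `|complex.Im x|)%:C)%C.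
Proof.
case: x => a b; rewrite normc_def /= lecR.
rewrite -[leRHS]ger0_norm ?addr_ge0 // -sqrtr_sqr ler_sqrt ?sqr_ge0 //.
by rewrite sqrrD !real_normK ?num_real // -addrA lerD2l lerDr mulrn_wge0 ?mulr_ge0.
Qed.

Lemma dominated_series (u : nat -> C) (v : nat -> R) :
  (forall n, `|u n| <= ((v n)%:C)%C) -> cvgn (series v) ->
  exists l, ccvg (fun n => \sum_(0 <= k < n) u k) l.
Proof.
move=> uv cv.
have v0 n : 0 <= v n by rewrite -lecR (le_trans (normr_ge0 _) (uv n)).
have cvg_part (f : C -> R) : (forall x, ((`|f x|)%:C)%C <= `|x|) ->
    cvgn (series (f \o u)).
  move=> f_le; apply: normed_cvg.
  apply: series_le_cvg cv => n //=.
  by rewrite -lecR (le_trans (f_le _)).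
have /cvg_ex[/= a ca] := cvg_part _ Re_norm_le.
have /cvg_ex[/= c cc] := cvg_part _ Im_norm_le.
exists (a +i* c)%C; apply/ccvgP => -[e e'].
rewrite ltcE /= => /andP[/eqP -> {e'} e0].
have e20 : 0 < e / 2 by rewrite divr_gt0.
move/cvgrPdist_lt/(_ _ e20) : ca => [N1 _ h1].
move/cvgrPdist_lt/(_ _ e20) : cc => [N2 _ h2].
exists (maxn N1 N2) => n; rewrite geq_max => /andP[/h1 /= n1 /h2 /= n2].
apply: le_lt_trans (norm_Re_Im_le _) _.
rewrite [X in _ < X](_ : _ = (e%:C)%C) // ltcR [e]splitr.
move: n1 n2; rewrite /series /=.
rewrite -Re_sum -Im_sum; case: (\sum_(0 <= k < n) u k) => x y /= n1 n2.
exact: ltrD.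
Qed.

Section Matrices.

Definition mcvg a b (u : nat -> 'M[C]_(a, b)) (l : 'M[C]_(a, b)) : Prop :=
  forall i j, ccvg (fun n => u n i j) (l i j).

Lemma mcvg_MX a b (u : nat -> 'M[C]_(a, b)) (l : 'M[C]_(a, b)) :
  mcvg u l <-> ((u : nat -> MX R a b) @ \oo --> (l : MX R a b)).
Proof.
split=> [h|h i j].
  apply/cvg_ballP => e e0.
  have : \forall n \near \oo, forall i j, `|l i j - u n i j| < e.
    apply: filter_forall => i; apply: filter_forall => j.
    by move: (h i j) => /cvgrPdist_lt; exact.
  by apply: filterS => n hn; split => // i j; exact: hn.
have /(_ l) := @coord_continuous C a b i j; exact: cvg_comp h.
Qed.

Lemma series_toE a b (u : nat -> 'M[C]_(a, b)) l :
  series_to u l <-> mcvg (fun n => \sum_(0 <= k < n) u k) l.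
Proof. by rewrite mcvg_MX. Qed.

Lemma mcvg_cst a b (l : 'M[C]_(a, b)) : mcvg (fun=> l) l.
Proof. by move=> i j; exact: ccvg_cst. Qed.

Lemma mcvg_ext a b (u v : nat -> 'M[C]_(a, b)) l :
  (forall n, u n = v n) -> mcvg u l -> mcvg v l.
Proof. by move=> /funext ->. Qed.

Lemma mcvgD a b (u v : nat -> 'M[C]_(a, b)) l m :
  mcvg u l -> mcvg v m -> mcvg (fun n => u n + v n) (l + m).
Proof.
move=> h1 h2 i j; have -> : (l + m) i j = l i j + m i j by rewrite mxE.
by apply: ccvg_ext (ccvgD (h1 i j) (h2 i j)) => n; rewrite mxE.
Qed.

Lemma mcvgZ a b (z : C) (u : nat -> 'M[C]_(a, b)) l :
  mcvg u l -> mcvg (fun n => z *: u n) (z *: l).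
Proof.
move=> h i j; rewrite mxE.
by apply: ccvg_ext (ccvgM (@ccvg_cst z) (h i j)) => n; rewrite !mxE.
Qed.

Lemma mcvgN a b (u : nat -> 'M[C]_(a, b)) l : mcvg u l -> mcvg (fun n => - u n) (- l).
Proof.
move=> h; rewrite -scaleN1r.
by apply: mcvg_ext (@mcvgZ _ _ (-1) _ _ h) => n; rewrite scaleN1r.
Qed.

Lemma mcvgB a b (u v : nat -> 'M[C]_(a, b)) l m :
  mcvg u l -> mcvg v m -> mcvg (fun n => u n - v n) (l - m).
Proof. by move=> h1 h2; apply: mcvgD h1 (mcvgN h2). Qed.

Lemma mcvgM a b c (u : nat -> 'M[C]_(a, b)) (v : nat -> 'M[C]_(b, c)) l m :
  mcvg u l -> mcvg v m -> mcvg (fun n => u n *m v n) (l *m m).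
Proof.
move=> h1 h2 i j; rewrite mxE.
apply: (@ccvg_ext (fun n => \sum_k u n i k * v n k j)); first by move=> n; rewrite mxE.
by apply: ccvg_sum => k; exact: ccvgM.
Qed.

Lemma mcvg_adj a b (u : nat -> 'M[C]_(a, b)) l :
  mcvg u l -> mcvg (fun n => adj (u n)) (adj l).
Proof.
move=> h i j; rewrite adjE; apply: ccvg_ext (ccvg_conj (h j i)) => n.
by rewrite adjE.
Qed.

Lemma mcvg_unique a b (u : nat -> 'M[C]_(a, b)) l m : mcvg u l -> mcvg u m -> l = m.
Proof. by move=> h1 h2; apply/matrixP => i j; exact: ccvg_unique (h1 i j) (h2 i j). Qed.

Lemma mcvg_shift a b (u : nat -> 'M[C]_(a, b)) l : mcvg u l -> mcvg (fun n => u n.+1) l.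
Proof. by move=> h i j; exact: (ccvg_shift (h i j)). Qed.

Lemma mcvg_unshift a b (u : nat -> 'M[C]_(a, b)) l :
  mcvg (fun n => u n.+1) l -> mcvg u l.
Proof. by move=> h i j; exact: (ccvg_unshift (h i j)). Qed.

Lemma mcvg_row_mx a b c (u : nat -> 'M[C]_(a, b)) (v : nat -> 'M[C]_(a, c)) l m :
  mcvg u l -> mcvg v m -> mcvg (fun n => row_mx (u n) (v n)) (row_mx l m).
Proof.
move=> h1 h2 i j; case: (split_ordP j) => k ->.
  by rewrite row_mxEl; apply: ccvg_ext (h1 i k) => n; rewrite row_mxEl.
by rewrite row_mxEr; apply: ccvg_ext (h2 i k) => n; rewrite row_mxEr.
Qed.

Lemma mcvg_hform n (u : nat -> 'M[C]_n) l v :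
  mcvg u l -> ccvg (fun k => hform (u k) v) (hform l v).
Proof.
by move=> h; have := mcvgM (mcvgM (@mcvg_cst _ _ (adj v)) h) (@mcvg_cst _ _ v); exact.
Qed.

Lemma dominated_matrix_series a b (u : nat -> 'M[C]_(a, b)) (v : nat -> R) :
  (forall n i j, `|u n i j| <= ((v n)%:C)%C) -> cvgn (series v) -> series_cvg u.
Proof.
move=> uv cv.
have h i j : exists l, ccvg (fun n => \sum_(0 <= k < n) u k i j) l.
  by apply: (dominated_series (v := v)).
have [l lP] := choice (fun ij => h ij.1 ij.2).
exists (\matrix_(i, j) l (i, j)); apply/series_toE => i j; rewrite mxE.
by apply: ccvg_ext (lP (i, j)) => n; rewrite summxE.
Qed.

Lemma series_terms_cvg0 a b (u : nat -> 'M[C]_(a, b)) : series_cvg u -> mcvg u 0.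
Proof.
move=> [l /series_toE h].
have := mcvgB (mcvg_shift h) h; rewrite subrr; apply: mcvg_ext => n.
by rewrite big_nat_recr //= addrAC subrr add0r.
Qed.

End Matrices.
End ComplexLimits.

Section Conjugation.
Variables (R : realType) (p : nat).
Local Notation C := R[i].
Local Notation J := (Jm R p).
Local Notation K := (Km R p).
Local Notation j := (jm R p).

Lemma conj_imaginary : ('i%C : C)^* = - 'i%C.
Proof. by apply/eqP; rewrite eq_complex /= oppr0 !eqxx. Qed.

Lemma mulKm_adj : K *m adj K = 1%:M.
Proof.
rewrite /Km adjZ /block_mx adj_col_mx !adj_row_mx !adjN !adj1 -scalemxAl -scalemxAr.
rewrite scalerA -/(block_mx _ _ _ _) -block_mxEh mulmx_block.
rewrite !(mulmxN, mulNmx) !mul1mx !opprK !subrr.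
have -> : (sqrtC 2)^-1 * ((sqrtC 2)^-1)^* = 2^-1 :> C.
  have -> : ((sqrtC (2 : C))^-1)^* = (sqrtC 2)^-1.
    by apply: CrealP; rewrite ger0_real // invr_ge0 sqrtC_ge0.
  by rewrite -invfM -expr2 sqrtCK.
have -> : 1%:M + 1%:M = 2%:M :> 'M[C]_p by rewrite -raddfD.
by rewrite -scalar_mx_block scale_scalar_mx mulVf // pnatr_eq0.
Qed.

Lemma adj_mulKm : adj K *m K = 1%:M.
Proof. exact: mulmx1C mulKm_adj. Qed.

Lemma Km_jm : K *m j *m adj K = J.
Proof.
have -> : K *m j = J *m K.
  rewrite /Km /jm /Jm -scalemxAl -scalemxAr; congr (_ *: _).
  rewrite !mulmx_block !mulmx0 !mul0mx !mulmx1 !mul1mx.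
  by rewrite !(mulmxN, mulNmx) !mulmx1 opprK !addr0 !add0r.
by rewrite -mulmxA mulKm_adj mulmx1.
Qed.

Variable b : nat -> 'M[C]_(p, p + p).

Lemma Csys_signature k : Csys b k = adj K *m signature_mx (b k) *m K.
Proof.
have conjZB (A B M N : 'M[C]_(p + p)) (x : C) :
    A *m (x *: M - N) *m B = x *: (A *m M *m B) - A *m N *m B.
  by rewrite mulmxBr mulmxBl -scalemxAr -scalemxAl.
rewrite /Csys /signature_mx conjZB !mulmxA; congr (_ - _).
by rewrite -Km_jm !mulmxA adj_mulKm mul1mx -mulmxA adj_mulKm mulmx1.
Qed.

Definition Wconj lam k := K *m Wsys b lam k *m adj K.

Lemma Wconj0 lam : Wconj lam 0 = 1%:M.
Proof. by rewrite /Wconj mulmx1 mulKm_adj. Qed.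

Lemma WconjS lam k : Wconj lam k.+1
  = Wconj lam k - ('i%C / lam) *: (J *m signature_mx (b k) *m Wconj lam k).
Proof.
have conjBZ (A B M N : 'M[C]_(p + p)) (x : C) :
    A *m (M - x *: N) *m B = A *m M *m B - x *: (A *m N *m B).
  by rewrite mulmxBr mulmxBl -scalemxAr -scalemxAl.
by rewrite /Wconj /= conjBZ Csys_signature -Km_jm !mulmxA.
Qed.

Lemma WconjS_mul q lam k (y : 'M[C]_(p + p, q)) : Wconj lam k.+1 *m y
  = Wconj lam k *m y
    - ('i%C / lam) *: (J *m signature_mx (b k) *m (Wconj lam k *m y)).
Proof. by rewrite WconjS mulmxBl -scalemxAl !mulmxA. Qed.

Definition initial_vec (F : 'M[C]_p) : 'M[C]_(p + p, p) := col_mx (- F) 1%:M.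

Lemma weyl_termE phi lam k : weyl_term b phi lam k
  = qf lam ^+ k *: (adj (Wconj lam k *m initial_vec ('i%C *: phi lam))
      *m signature_mx (b k) *m (Wconj lam k *m initial_vec ('i%C *: phi lam))).
Proof.
have scaleM (A : 'M[C]_(p, p + p)) (M : 'M[C]_(p + p)) (B : 'M[C]_(p + p, p)) (x : C) :
    A *m (x *: M) *m B = x *: (A *m M *m B) by rewrite -scalemxAr -scalemxAl.
rewrite /weyl_term scaleM; congr (_ *: _).
rewrite Csys_signature /initial_vec /Wconj.
have -> : 'i%C *: adj (phi lam) = adj (- ('i%C *: phi lam)).
  by rewrite adjN adjZ conj_imaginary scaleNr opprK.
rewrite scaleNr adjM adj_col_mx adj1.
move: (signature_mx (b k)) (Wsys b lam k) (K) (row_mx _ _) (col_mx _ _) => S W K' r u.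
by rewrite !adjM adjK !mulmxA.
Qed.

End Conjugation.

Section Weyl.
Variables (R : realType) (p : nat).
Local Notation C := R[i].
Local Notation J := (Jm R p).
Variable b : nat -> 'M[C]_(p, p + p).
Hypothesis adm : admissible b.
Variable lam : C.
Hypothesis lamP : Clower lam.

Let c := 'i%C / lam.
Let q := qf lam.

Lemma Clower_neq0 : lam != 0.
Proof. by apply/eqP => e; move: lamP; rewrite e /Clower /= ltxx. Qed.

Lemma qf_gt0 : 0 < q.
Proof.
by rewrite divr_gt0 ?ltr_wpDl ?exprn_ge0 // exprn_gt0 // normr_gt0 Clower_neq0.
Qed.

Lemma conj_step : c^* = - 'i%C / lam^*.
Proof. by rewrite [LHS]rmorphM; congr (_ * _); [exact: conj_imaginary | exact: fmorphV]. Qed.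

Lemma qf_mul : q * (1 + c * c^*) = 1.
Proof.
have l0 := Clower_neq0; have l1 : lam^* != 0 by rewrite fmorph_eq0.
have h : 0 < `|lam| ^+ 2 + 1 by rewrite ltr_wpDl ?exprn_ge0.
rewrite conj_step /q /qf /c.
have -> : 'i%C / lam * (- 'i%C / lam^*) = (`|lam| ^+ 2)^-1.
  rewrite normCK mulrACA mulrN -expr2 (_ : ('i%C : C) ^+ 2 = -1) ?opprK ?mul1r ?invfM //.
  exact: sqr_i.
have n0 : `|lam| ^+ 2 != 0 by rewrite expf_neq0 // normr_eq0.
move: h n0; move: (`|lam| ^+ 2) => t h n0.
by field; rewrite n0 gt_eqF.
Qed.

Lemma gain_gt0 : 0 < - (q * (c + c^*)).
Proof.
have l0 := Clower_neq0; have l1 : lam^* != 0 by rewrite fmorph_eq0.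
rewrite -mulrN mulr_gt0 ?qf_gt0 //.
have -> : - (c + c^*) = ('i%C * (lam - lam^*)) / (lam * lam^*).
  by rewrite conj_step /c; field; rewrite l0 l1.
rewrite -normCK divr_gt0 ?exprn_gt0 ?normr_gt0 //.
move: lamP; case: lam => x y; rewrite /Clower /= => y0.
have -> : ('i * ((x +i* y) - (x +i* y)^*))%C = ((- (y + y))%:C)%C.
  by apply/eqP; rewrite eq_complex /=; apply/andP; split; apply/eqP; ring.
by rewrite ltcR oppr_gt0 -mulr2n pmulrn_llt0.
Qed.

Definition J_energy y k := q ^+ k * hform J (Wconj b lam k *m y).
Definition S_energy y k := q ^+ k * hform (signature_mx (b k)) (Wconj b lam k *m y).

Lemma J_energyS y k : J_energy y k.+1 = J_energy y k + (- (q * (c + c^*))) * S_energy y k.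
Proof.
rewrite /J_energy /S_energy WconjS_mul; move: (Wconj b lam k *m y) => w.
rewrite (signature_step (adm k) c w) exprSr.
move: qf_mul (hform J w) (hform (signature_mx (b k)) w) => qc x s.
rewrite mulrBr mulrA -(mulrA (q ^+ k)) qc.
by ring.
Qed.

Lemma S_energy_ge0 y k : 0 <= S_energy y k.
Proof. by rewrite mulr_ge0 ?exprn_ge0 ?(ltW qf_gt0) ?(signature_ge0 (adm k)). Qed.

Lemma J_energy_le_S y k : J_energy y k <= S_energy y k.
Proof.
by rewrite ler_pM2l ?exprn_gt0 ?qf_gt0 //; exact: (signature_ge (adm k)).
Qed.

Lemma J_energy_nondecreasing y k d : J_energy y k <= J_energy y (k + d).
Proof.
elim: d => [|d IH]; first by rewrite addn0.
apply: le_trans IH _; rewrite addnS J_energyS lerDl.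
by rewrite mulr_ge0 ?S_energy_ge0 // ltW // gain_gt0.
Qed.

Lemma J_energy_le0 y n : ccvg (S_energy y) 0 -> J_energy y n <= 0.
Proof.
move=> h; have {}h : ccvg (fun k => S_energy y (n + k)) 0.
  elim: n => [|n IH]; first exact: h.
  by apply: ccvg_ext (ccvg_shift IH) => k; rewrite addnS addSn.
rewrite -oppr_ge0 -[- _]add0r.
apply: (ccvg_ge0 _ (ccvgD h (ccvgN (@ccvg_cst R (J_energy y n))))) => k.
by rewrite subr_ge0 (le_trans (J_energy_nondecreasing _ _ k)) ?J_energy_le_S.
Qed.

Lemma J_energy_sum y n :
  (- (q * (c + c^*))) * \sum_(0 <= k < n) S_energy y k = J_energy y n - J_energy y 0.
Proof.
elim: n => [|n IH]; first by rewrite big_geq // mulr0 subrr.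
rewrite (big_nat_recr _ _ _ (leq0n n)) /= mulrDr IH (J_energyS y n).
exact: addrAC.
Qed.

Section WeylTerm.
Variable phi : C -> 'M[C]_p.
Let u := initial_vec ('i%C *: phi lam).

Lemma hform_weyl_term k v : hform (weyl_term b phi lam k) v = S_energy (u *m v) k.
Proof. by rewrite weyl_termE hformZ hform_congr -mulmxA. Qed.

Lemma weyl_S_cvg0 v : series_cvg (weyl_term b phi lam) -> ccvg (S_energy (u *m v)) 0.
Proof.
move=> /series_terms_cvg0/(@mcvg_hform _ _ _ _ v); rewrite hform0.
by apply: ccvg_ext => k; exact: hform_weyl_term.
Qed.

Lemma weyl_nonpositive : series_cvg (weyl_term b phi lam) ->
  forall n v, hform J (Wconj b lam n *m u *m v) <= 0.
Proof.
move=> /weyl_S_cvg0 h n v; have := J_energy_le0 n (h v).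
by rewrite /J_energy pmulr_rle0 ?exprn_gt0 ?qf_gt0 // mulmxA.
Qed.

End WeylTerm.
End Weyl.

Section Convergence.
Variable R : realType.
Local Notation C := R[i].

Lemma adj_delta m n (i : 'I_m) (j : 'I_n) : adj (delta_mx i j) = delta_mx j i :> 'M[C]_(n, m).
Proof. by apply/matrixP => k l; rewrite adjE !mxE andbC conjC_nat. Qed.

Lemma hform_delta n (M : 'M[C]_n) i : hform M (delta_mx i 0) = M i i.
Proof.
by rewrite /hform adj_delta -rowE -colE !mxE.
Qed.

Lemma psd_entry_le n (M : 'M[C]_n) i j : adj M = M -> (forall v, 0 <= hform M v) ->
  `|M i j| <= \sum_k hform M (delta_mx k 0).
Proof.
move=> Mh Mp; have Mji : M j i = (M i j)^* by rewrite -adjE Mh.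
have tr k : M k k <= \sum_l hform M (delta_mx l 0).
  by rewrite (bigD1 k) //= hform_delta lerDl sumr_ge0.
have [->|M0] := eqVneq (M i j) 0; first by rewrite normr0 sumr_ge0.
pose c := `|M i j| / M i j.
have cM : c * M i j = `|M i j| by rewrite divfK.
have cc : c * c^* = 1.
  by rewrite -normCK normrM normr_id normfV mulfV ?expr1n // normr_eq0.
have := Mp (delta_mx i 0 - c *: delta_mx j 0).
rewrite hform_subZ !hform_delta cc mul1r.
have entry k l : (adj (delta_mx k 0 : 'cV[C]_n) *m M *m (delta_mx l 0 : 'cV[C]_n)) 0 0 = M k l.
  by rewrite adj_delta -rowE -[_ *m _]colE !mxE.
have cM' : c^* * (M i j)^* = `|M i j|.
  transitivity ((c * M i j)^*); first by rewrite [RHS]rmorphM.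
  by rewrite cM; apply: CrealP; exact: normr_real.
rewrite !entry Mji cM cM' => h.
have h2 := lerD (tr i) (tr j).
have : `|M i j| *+ 2 <= M i i + M j j.
  rewrite -subr_ge0 (_ : _ - _ = M i i - `|M i j| - `|M i j| + M j j) //.
  by rewrite mulr2n; ring.
move=> /le_trans/(_ h2); rewrite -mulr2n.
by rewrite lerMn2r.
Qed.

Lemma complex_ge0_Re (x : C) : 0 <= x -> x = ((complex.Re x)%:C)%C.
Proof. by case: x => a b; rewrite lecE /= => /andP[/eqP -> _]. Qed.

Lemma Re_ge0 (x : C) : 0 <= x -> 0 <= complex.Re x.
Proof. by case: x => a b; rewrite lecE /= => /andP[_]. Qed.

Lemma psd_series_cvg n (u : nat -> 'M[C]_n) (B : 'cV[C]_n -> C) :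
  (forall k, adj (u k) = u k) -> (forall k v, 0 <= hform (u k) v) ->
  (forall N v, \sum_(0 <= k < N) hform (u k) v <= B v) -> series_cvg u.
Proof.
move=> uh u0 uB.
pose t k := \sum_i hform (u k) (delta_mx i 0).
have t0 k : 0 <= t k by apply: sumr_ge0.
apply: (@dominated_matrix_series R n n u (fun k => complex.Re (t k))).
  by move=> k i j; rewrite -complex_ge0_Re //; exact: psd_entry_le.
apply: nondecreasing_is_cvgn.
  by apply: nondecreasing_series => k _ _; rewrite -lecR -complex_ge0_Re.
exists (complex.Re (\sum_i B (delta_mx i 0))) => _ [N _ <-].
rewrite /series /= -Re_sum.
have : \sum_(0 <= k < N) t k <= \sum_i B (delta_mx i 0).
  by rewrite exchange_big; apply: ler_sum => i _.
by rewrite lecE => /andP[].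
Qed.

End Convergence.

Section WeylCriterion.
Variables (R : realType) (p : nat).
Local Notation C := R[i].
Local Notation J := (Jm R p).
Variable b : nat -> 'M[C]_(p, p + p).
Hypothesis adm : admissible b.
Variable lam : C.
Hypothesis lamP : Clower lam.

Lemma weyl_series_cvg phi :
  (forall n v, hform J (Wconj b lam n *m initial_vec ('i%C *: phi lam) *m v) <= 0) ->
  series_cvg (weyl_term b phi lam).
Proof.
move=> Jle0; set u := initial_vec _ in Jle0.
pose d := - (qf lam * ('i%C / lam + ('i%C / lam)^*)).
have d0 : 0 < d by exact: gain_gt0.
apply: (psd_series_cvg (B := fun v => - J_energy b lam (u *m v) 0 / d)).
- move=> k; rewrite weyl_termE adjZ; congr (_ *: _).
    by apply: CrealP; rewrite ger0_real // exprn_ge0 // ltW // qf_gt0.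
  move: (Wconj b lam k *m _) => A.
  by rewrite !adjM adjK adj_signature mulmxA.
- by move=> k v; rewrite hform_weyl_term S_energy_ge0.
- move=> N v; rewrite ler_pdivlMr // mulrC.
  under eq_bigr do rewrite hform_weyl_term.
  rewrite (J_energy_sum adm lamP) -[leRHS]add0r lerD2r.
  by rewrite /J_energy pmulr_rle0 ?exprn_gt0 ?qf_gt0 // mulmxA.
Qed.

Lemma weyl_unique phi phi' :
  series_cvg (weyl_term b phi lam) -> series_cvg (weyl_term b phi' lam) ->
  phi lam = phi' lam.
Proof.
move=> h h'.
pose e := 'i%C *: (phi' lam - phi lam) : 'M[C]_p.
have ue : initial_vec ('i%C *: phi lam) - initial_vec ('i%C *: phi' lam) = col_mx e 0.
  by rewrite opp_col_mx add_col_mx subrr opprK addrC -scalerBr.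
suff e0 (v : 'cV[C]_p) : e *m v = 0.
  have : e = 0.
    apply/matrixP => i j; have /matrixP/(_ i 0) := e0 (delta_mx j 0).
    by rewrite -colE !mxE.
  move=> /eqP; rewrite scaler_eq0 => /orP[/eqP /(congr1 (@complex.Im R)) /eqP|].
    by rewrite /= oner_eq0.
  by rewrite subr_eq0 => /eqP ->.
have S0 : ccvg (S_energy b lam (col_mx e 0 *m v)) 0.
  have hs : ccvg (fun k => 2 * (S_energy b lam (initial_vec ('i%C *: phi lam) *m v) k
      + S_energy b lam (initial_vec ('i%C *: phi' lam) *m v) k)) 0.
    have := ccvgD (weyl_S_cvg0 v h) (weyl_S_cvg0 v h'); rewrite addr0.
    by move=> /(ccvgM (@ccvg_cst R 2)); rewrite mulr0.
  apply/ccvgP => x x0; move/ccvgP/(_ x x0) : hs => [N hN]; exists N => n /hN.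
  rewrite !sub0r !normrN; apply: le_lt_trans.
  have S_ge0 y : 0 <= S_energy b lam y n by exact: S_energy_ge0.
  rewrite !ger0_norm // ?mulr_ge0 ?addr_ge0 //.
  rewrite -ue mulmxBl /S_energy mulmxBr -mulrDr mulrCA.
  rewrite ler_pM2l ?exprn_gt0 ?qf_gt0 // -hform_polar lerDr.
  exact: (signature_ge0 (adm n)).
have J0 : J_energy b lam (col_mx e 0 *m v) 0 = 0.
  rewrite /J_energy Wconj0 mul1mx mul_col_mx mul0mx hform_Jm.
  by rewrite mulmx0 adj0 mul0mx !mxE addr0 mulr0.
have := J_energy_le0 adm lamP 1 S0.
rewrite (J_energyS adm lamP) J0 add0r pmulr_rle0 ?gain_gt0 // => S00.
have : S_energy b lam (col_mx e 0 *m v) 0 = 0.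
  by apply/eqP; rewrite eq_le S00 S_energy_ge0.
move: J0; rewrite /S_energy /J_energy expr0 !mul1r Wconj0 !mul1mx => J0.
rewrite hform_signature J0 subr0 => /eqP; rewrite mulf_eq0 pnatr_eq0 /= => /eqP.
move=> /hform_gram_eq0; rewrite -{1}[b 0%N]hsubmxK mul_col_mx mul0mx mul_row_col.
rewrite mulmx0 addr0 => /(congr1 (mulmx (invmx (lsubmx (b 0%N))))).
by rewrite mulKmx ?mulmx0 // normalized_row_lsub_unit.
Qed.

End WeylCriterion.

Section LinkedLimit.
Variables (R : realType) (p : nat).
Local Notation C := R[i].
Local Notation J := (Jm R p).
Variables (b : nat -> 'M[C]_(p, p + p)) (al : nat -> 'M[C]_p).
Variable X : nat -> nat -> 'M[C]_p.
Hypothesis lX : linked b al X.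

Lemma linked_coef_bound : exists2 B : C, 0 <= B &
  forall k i j, `|al k.+1 i j| <= B.
Proof.
pose t i := toeplitz_entry al 0 0 i i.
have rowX k i : \sum_m `|X k 0 i m| ^+ 2 <= t i.
  have -> : t i = toeplitz_entry al k k i i by rewrite /t /toeplitz_entry !ltnn !eqxx.
  rewrite -(linked_toeplitz lX (ltnSn k) (ltnSn k)) summxE.
  under [X in _ <= X]eq_bigr do rewrite gram_entry.
  rewrite big_ord_recl lerDl sumr_ge0 // => l _.
  by rewrite sumr_ge0 // => m _; rewrite exprn_ge0.
have t_ge0 i : 0 <= t i.
  by apply: le_trans (rowX 0%N i); rewrite sumr_ge0 // => m _; rewrite exprn_ge0.
have t_le i : t i <= \sum_j t j by rewrite (bigD1 i) //= lerDl sumr_ge0.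
exists (\sum_i t i + \sum_i t i); first by rewrite addr_ge0 // sumr_ge0.
move=> k i j; apply: le_trans (lerD (t_le i) (t_le j)).
apply: le_trans (lerD (rowX k.+1 i) (rowX 0%N j)).
have -> : al k.+1 = toeplitz_entry al k.+1 0 by [].
rewrite -(linked_toeplitz lX (N := k.+2)) // big_ord_recl /= big1 ?addr0 => [|l _]; last first.
  by rewrite (linked_lower lX (n := 0%N)) // adj0 mulmx0.
rewrite mxE -big_split /=.
apply: le_trans (ler_norm_sum _ _ _) _; apply: ler_sum => m _.
rewrite normrM adjE norm_conjC.
move: (`|X _ _ _ _|) (normr_ge0 (X k.+1 0 i m)) (`|X 0 0 j m|) (normr_ge0 (X 0 0 j m)).
move=> x x0 y y0.
have : 0 <= (x - y) ^+ 2 by rewrite real_exprn_even_ge0 // rpredB // ger0_real.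
move=> h; rewrite -subr_ge0.
have -> : x ^+ 2 + y ^+ 2 - x * y = (x - y) ^+ 2 + x * y by ring.
by rewrite addr_ge0 // mulr_ge0.
Qed.

Lemma linked_series_cvg z : udisc z -> series_cvg (fun k => z ^+ k.+1 *: al k.+1).
Proof.
move=> z1; have [B B0 Bal] := linked_coef_bound.
apply: (dominated_matrix_series (v := geometric (complex.Re B) (complex.Re `|z|))).
  move=> k i j; rewrite mxE normrM normrX /=.
  have -> : ((complex.Re B * complex.Re `|z| ^+ k)%:C)%C = B * `|z| ^+ k.
    by rewrite rmorphM rmorphXn /= -!complex_ge0_Re.
  rewrite mulrC; apply: ler_pM; rewrite ?exprn_ge0 //.
  by rewrite exprS ler_piMl ?exprn_ge0 // ltW.
apply: is_cvg_geometric_series.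
have := z1; rewrite /udisc /= {1}(complex_ge0_Re (normr_ge0 z)) => h.
rewrite ger0_norm; first by rewrite -ltcR.
exact: (Re_ge0 (normr_ge0 z)).
Qed.

Section Point.
Variables (z : C) (F : 'M[C]_p).
Hypothesis z1 : udisc z.
Hypothesis FP : series_to (fun k => z ^+ k.+1 *: al k.+1) (F - al 0%N).

Fixpoint limit_row n : 'M[C]_(p, p + p) :=
  if n is n'.+1 then
    limit_row n' - (1 - z) *: (limit_row n' *m J *m adj (b n') *m b n')
  else row_mx 1%:M F.

Lemma chi_tail_cvg n : mcvg (fun M => chi_tail b X z M n) (limit_row n).
Proof.
elim: n => [|n IH].
  have /series_toE hF := FP.
  have := mcvg_row_mx (@mcvg_cst R p p 1%:M) (mcvgD (@mcvg_cst R p p (al 0%N)) hF).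
  rewrite [al 0%N + _]addrC subrK; apply: mcvg_ext => M.
  by rewrite (chi_tail0 lX) big_mkord.
have hpsi : mcvg (fun M => psi X z M.+1 n) (limit_row n *m J *m adj (b n)).
  apply: mcvg_ext (mcvgM (mcvgM IH (@mcvg_cst R _ _ J)) (@mcvg_cst R _ _ (adj (b n)))) => M.
  by rewrite (chi_tail_J lX).
have hchi : mcvg (fun M => chi X z M n) ((1 - z) *: (limit_row n *m J *m adj (b n))).
  rewrite scalerBl scale1r.
  exact: (mcvgB hpsi (@mcvgZ R _ _ z _ _ (mcvg_unshift hpsi))).
rewrite /= scalemxAl.
apply: mcvg_ext (mcvgB IH (mcvgM hchi (@mcvg_cst R _ _ (b n)))) => M.
by rewrite (chi_tailS lX).
Qed.

Lemma limit_row_ge0 n v : 0 <= hform (limit_row n *m J *m adj (limit_row n)) v.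
Proof.
set f := hform _ _.
pose fM M := hform (chi_tail b X z M n *m J *m adj (chi_tail b X z M n)) v.
pose q M := hform (psi_energy X z n M M) v.
have q0 M : 0 <= q M by exact: psi_energy_ge0.
have fME M : fM M = q M.+1 - (z * z^*) * q M.
  by rewrite /fM (chi_tail_norm lX) hformB hformZ.
have rho0 : 0 <= z * z^* by rewrite -normCK exprn_ge0.
have rho1 : z * z^* <= 1 by rewrite -normCK expr_le1 // ltW.
have fM_real M : fM M \is Num.real.
  rewrite fME; apply: realB; first exact: ger0_real (q0 _).
  exact: realM (ger0_real rho0) (ger0_real (q0 _)).
have cf : ccvg fM f.
  have h := mcvgM (mcvgM (@chi_tail_cvg n) (@mcvg_cst R _ _ J)) (mcvg_adj (@chi_tail_cvg n)).
  exact: (@mcvg_hform R p _ _ v h).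
have f_real : f \is Num.real.
  apply/CrealP; apply: hform_real.
  by rewrite !adjM adjK adj_Jm mulmxA.
case: (real_leP (@real0 C) f_real) => // f0.
pose e := - f / 2.
have e0 : 0 < e by rewrite divr_gt0 // oppr_gt0.
have [N hN] := (ccvgP _ _).1 cf e e0.
have step M : (N <= M)%N -> q M.+1 <= q M - e.
  have hr : f - fM M \is Num.real := realB f_real (fM_real M).
  move=> /hN; rewrite (real_ltr_norml _ hr) => /andP[h _].
  have : fM M < - e.
    rewrite -subr_gt0; move: h; rewrite -subr_gt0 opprK.
    suff -> : f - fM M + e = - e - fM M by [].
    by rewrite /e; field.
  rewrite fME => h'.
  rewrite -(subrK ((z * z^*) * q M) (q M.+1)) addrC.
  by apply: lerD; rewrite ?ler_piMl // ltW.
have qN k : q (N + k)%N <= q N - k%:R * e.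
  elim: k => [|k IH]; first by rewrite addn0 mul0r subr0.
  rewrite addnS; apply: le_trans (step _ (leq_addr _ _)) _.
  by rewrite -natr1 mulrDl mul1r opprD addrA lerD2r.
pose x := complex.Re (q N) / complex.Re e.
have eR : 0 < complex.Re e by rewrite -ltcR -complex_ge0_Re // ltW.
have qR : 0 <= complex.Re (q N) by exact: Re_ge0.
have x0 : 0 <= x by rewrite divr_ge0 // ltW.
have := archi_boundP x0; rewrite ltr_pdivrMr // -ltcR rmorphM rmorph_nat /=.
rewrite -!complex_ge0_Re ?(ltW e0) // => h.
have := le_trans (q0 _) (qN (Num.bound x)); rewrite subr_ge0 => /(lt_le_trans h).
by rewrite ltxx.
Qed.

Lemma limit_row0_free (v : 'cV[C]_p) : adj (limit_row 0) *m v = 0 -> v = 0.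
Proof.
rewrite /= adj_row_mx adj1 mul_col_mx mul1mx => h.
by have := congr1 usubmx h; rewrite col_mxKu linear0.
Qed.

Lemma limit_row_free n (v : 'cV[C]_p) : z != 0 -> adj (limit_row n) *m v = 0 -> v = 0.
Proof.
move=> z0; elim: n v => [|n IH] v; first exact: limit_row0_free.
move=> h; apply: IH; move: h => /=; set r := limit_row n.
pose P := J *m adj (b n) *m b n.
have PP : P *m P = P.
  by rewrite /P !mulmxA -(mulmxA _ (b n) J) -(mulmxA _ (b n *m J))
    (linked_admissible lX) mulmx1.
have inv : (1%:M - (1 - z) *: P) *m (1%:M - (1 - z^-1) *: P) = 1%:M.
  rewrite mulmxBl !mulmxBr !mul1mx mulmx1 -scalemxAl -scalemxAr PP.
  by apply/matrixP => i j; rewrite !mxE; field.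
have -> : r - (1 - z) *: (r *m J *m adj (b n) *m b n) = r *m (1%:M - (1 - z) *: P).
  by rewrite mulmxBr mulmx1 -scalemxAr /P !mulmxA.
rewrite adjM -mulmxA => /(congr1 (mulmx (adj (1%:M - (1 - z^-1) *: P)))).
by rewrite mulmxA -adjM inv adj1 mul1mx mulmx0.
Qed.

Variable lam : C.
Hypothesis lamP : Clower lam.
Hypothesis lam_z : z * (lam - 'i%C) = lam + 'i%C.

Lemma limit_row_annihilates n : limit_row n *m (Wconj b lam n *m initial_vec F) = 0.
Proof.
elim: n => [|n IH].
  by rewrite Wconj0 mul1mx /= mul_row_col mul1mx mulmx1 addNr.
rewrite WconjS_mul /=; move: (Wconj b lam n *m initial_vec F) (limit_row n) IH => w r rw.
have l0 := Clower_neq0 lamP.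
pose c := 'i%C / lam; rewrite -/c.
have cz : 1 + c = z * (1 - c).
  apply/eqP; rewrite -subr_eq0.
  have -> : 1 + c - z * (1 - c) = (lam + 'i%C - z * (lam - 'i%C)) / lam.
    by rewrite /c; field.
  by rewrite lam_z subrr mul0r.
have bJb := linked_admissible lX n.
have e1 : r *m J *m adj (b n) *m b n *m (J *m signature_mx (b n) *m w)
    = r *m J *m adj (b n) *m b n *m w.
  rewrite /signature_mx mulmxBr mulJJ mulmxBl mul1mx -scalemxAr -scalemxAl mulmxBr -scalemxAr.
  rewrite !mulmxA -(mulmxA _ (b n) J) -(mulmxA _ (b n *m J)) bJb mulmx1.
  by apply/matrixP => i j; rewrite !mxE; ring.
have e2 : r *m (J *m signature_mx (b n) *m w) = 2 *: (r *m J *m adj (b n) *m b n *m w).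
  rewrite /signature_mx mulmxBr mulJJ mulmxBl mul1mx -scalemxAr -scalemxAl mulmxBr rw subr0.
  by rewrite -scalemxAr !mulmxA.
have -> : (r - (1 - z) *: (r *m J *m adj (b n) *m b n))
      *m (w - c *: (J *m signature_mx (b n) *m w))
    = (z * (1 - c) - (1 + c)) *: (r *m J *m adj (b n) *m b n *m w).
  rewrite mulmxBr !mulmxBl -!scalemxAl -!scalemxAr rw e1 e2.
  by apply/matrixP => i j; rewrite !mxE; ring.
by rewrite cz subrr scale0r.
Qed.

Lemma linked_J_nonpositive n v :
  hform J (Wconj b lam n *m initial_vec F *m v) <= 0.
Proof.
have general k : z != 0 \/ k = 0%N -> hform J (Wconj b lam k *m initial_vec F *m v) <= 0.
  move=> zk; apply: (Jm_orthogonal_le0 (r := limit_row k)).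
  - exact: limit_row_ge0.
  - by case: zk => [z0 w|->]; [exact: limit_row_free | exact: limit_row0_free].
  - by rewrite mulmxA limit_row_annihilates mul0mx.
have [z0|z0] := eqVneq z 0; last by apply: general; left.
case: n => [|n]; first by apply: general; right.
(* At z = 0, i.e. lam = - i, each step multiplies by twice the projector J b^* b. *)
have F0 : F = al 0%N.
  apply/eqP; rewrite -subr_eq0; apply/eqP.
  have /series_toE h := FP; apply: (mcvg_unique h).
  apply: mcvg_ext (@mcvg_cst R p p 0) => N; rewrite big1 // => k _.
  by rewrite z0 expr0n scale0r.
have c1 : 'i%C / lam = -1.
  have -> : 'i%C = - lam by apply/eqP; rewrite -addr_eq0 addrC -lam_z z0 mul0r.
  by rewrite mulNr divff // (Clower_neq0 lamP).
suff -> : Wconj b lam n.+1 *m initial_vec F = 0 by rewrite mul0mx /hform mulmx0 mxE.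
elim: n => [|n IH]; last by rewrite WconjS_mul IH mulmx0 scaler0 subr0.
have b0 : b 0%N *m initial_vec F = 0.
  have h := linked_rows lX 0; rewrite !big_ord1 /= in h.
  apply: (can_inj (mulKmx (linked_diag lX 0))); rewrite mulmx0 mulmxA h F0.
  by rewrite mul_row_col mul1mx mulmx1 addNr.
rewrite WconjS_mul Wconj0 mul1mx c1 scaleN1r opprK.
rewrite /signature_mx mulmxBr mulJJ mulmxBl mul1mx addrC subrK.
by rewrite -scalemxAr -scalemxAl !mulmxA -(mulmxA _ (b 0%N)) b0 mulmx0 scaler0.
Qed.

End Point.
End LinkedLimit.

Section PowerSeries.
Variable R : realType.
Local Notation C := R[i].

Lemma geometric_tail_le (y : C) N : 0 <= y -> y <= 2^-1 ->
  \sum_(0 <= k < N) y ^+ k.+1 <= y + y.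
Proof.
move=> y0 y2; suff : \sum_(0 <= k < N) y ^+ k.+1 <= y + y - (y + y) * y ^+ N.
  move/le_trans; apply; rewrite lerBlDr lerDl mulr_ge0 ?addr_ge0 ?exprn_ge0 //.
elim: N => [|N IH]; first by rewrite big_geq // expr0 mulr1 subrr.
rewrite big_nat_recr //= (le_trans (lerD IH (lexx _))) //.
rewrite -subr_ge0 [X in 0 <= X](_ : _ = y * y ^+ N * (1 - (y + y))).
  rewrite mulr_ge0 ?mulr_ge0 ?exprn_ge0 // subr_ge0 (le_trans (lerD y2 y2)) //.
  by rewrite [leRHS]splitr div1r.
by rewrite !exprS; ring.
Qed.

Lemma power_series_constant_eq0 (t : nat -> C) :
  (forall z : C, z != 0 -> `|z| < 1 ->
     ccvg (fun N => \sum_(0 <= k < N) z ^+ k * t k) 0) -> t 0%N = 0.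
Proof.
move=> H; apply/eqP/negP => /negP t0.
have h2 : (0 : C) < 2^-1 by rewrite invr_gt0 ltr0n.
have [N0 hN0] : exists N, forall n, (N <= n)%N -> `|t n| <= 2 ^+ n.
  have h21 : `|2^-1 : C| < 1 by rewrite gtr0_norm // invf_lt1 ?ltr0n // ltr1n.
  have := H _ (lt0r_neq0 h2) h21 => h.
  have := ccvgD (ccvg_shift h) (ccvgN h); rewrite oppr0 addr0.
  move=> /ccvgP/(_ 1 ltr01)[N hN]; exists N => n /hN.
  rewrite sub0r normrN big_nat_recr //= addrAC subrr add0r normrM.
  rewrite gtr0_norm ?exprn_gt0 // exprVn mulrC ltr_pdivrMr ?exprn_gt0 ?ltr0n // mul1r.
  exact: ltW.
pose M : C := 1 + \sum_(0 <= k < N0) `|t k|.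
have M0 : 0 < M by rewrite ltr_wpDr // sumr_ge0.
have tM k : `|t k| <= M * 2 ^+ k.
  have p1 : (1 : C) <= 2 ^+ k by rewrite exprn_ege1 // ler1n.
  have [kN|/hN0 h] := ltnP k N0; last first.
    apply: (le_trans h); rewrite -[leLHS]mul1r ler_wpM2r ?exprn_ge0 //.
    by rewrite lerDl sumr_ge0.
  rewrite -[leLHS]mulr1; apply: ler_pM => //.
  rewrite /M big_mkord (bigD1 (Ordinal kN)) //= addrCA lerDl addr_ge0 ?sumr_ge0 //.
pose D : C := `|t 0%N| + 8 * M.
have a0 : 0 < `|t 0%N| by rewrite normr_gt0.
have D0 : 0 < D by rewrite addr_gt0 // mulr_gt0.
pose x : C := `|t 0%N| / D / 4.
have x0 : 0 < x by rewrite !divr_gt0 // ltr0n.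
have aD : `|t 0%N| / D <= 1 by rewrite ler_pdivrMr // mul1r lerDl mulr_ge0 // ltW.
have x4 : x <= 4^-1 by rewrite /x ler_piMl // invr_ge0 ler0n.
have xy : x * 2 <= 2^-1.
  apply: le_trans (ler_wpM2r _ x4) _; rewrite ?ler0n //.
  by rewrite (natrM _ 2 2) invfM -mulrA mulVf ?mulr1 ?pnatr_eq0.
have x1 : `|x| < 1.
  rewrite gtr0_norm //; apply: le_lt_trans x4 _.
  by rewrite invf_lt1 ?ltr0n // ltr1n.
have := H x (lt0r_neq0 x0) x1 => /ccvg_shift/ccvgP/(_ (`|t 0%N| / 4)).
have a4 : 0 < `|t 0%N| / 4 by rewrite divr_gt0 // ltr0n.
move=> /(_ a4)[N /(_ N (leqnn N))]; rewrite sub0r normrN big_nat_recl //= expr0 mul1r.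
set s := \sum_(0 <= k < N) _ => h.
have s_le : `|s| <= `|t 0%N| / 2.
  apply: le_trans (_ : M * (x * 2 + x * 2) <= _).
    apply: le_trans (ler_norm_sum _ _ _) _.
    apply: le_trans (ler_wpM2l (ltW M0) (geometric_tail_le N _ xy)); last first.
      by rewrite mulr_ge0 // ltW.
    rewrite mulr_sumr; apply: ler_sum => k _.
    rewrite normrM normrX (gtr0_norm x0) [(x * 2) ^+ _]exprMn [M * _]mulrCA.
    by apply: ler_wpM2l (tM _); rewrite exprn_ge0 // ltW.
  rewrite /x (_ : M * _ = `|t 0%N| / 8 * (8 * M / D)); last by field; rewrite gt_eqF.
  apply: le_trans (_ : `|t 0%N| / 8 * 1 <= _).
    rewrite ler_wpM2l ?divr_ge0 ?ler0n // ler_pdivrMr // mul1r lerDr.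
    exact: ltW.
  by rewrite mulr1 ler_wpM2l // lef_pV2 ?posrE ?ltr0n // ler_nat.
have : `|t 0%N| < `|t 0%N| / 4 + `|t 0%N| / 2.
  rewrite -{1}(addrK s (t 0%N)); apply: le_lt_trans (ler_normB _ _) _.
  exact: ltr_leD.
rewrite -mulrDr ltr_pMr // => h1.
have h2' : 4^-1 + 2^-1 < 1 :> C.
  have -> : 4^-1 + 2^-1 = 3 / 4 :> C by field.
  by rewrite ltr_pdivrMr ?ltr0n // mul1r ltr_nat.
by have := lt_trans h1 h2'; rewrite ltxx.
Qed.

Lemma power_series_eq0 (t : nat -> C) :
  (forall z : C, z != 0 -> `|z| < 1 ->
     ccvg (fun N => \sum_(0 <= k < N) z ^+ k * t k) 0) -> forall n, t n = 0.
Proof.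
move=> H n; elim: n t H => [|n IH] t H; first exact: power_series_constant_eq0.
apply: (IH (fun k => t k.+1)) => z z0 z1.
have := ccvgM (@ccvg_cst R z^-1) (ccvg_shift (H z z0 z1)); rewrite mulr0.
apply: ccvg_ext => N; rewrite big_nat_recl //= (power_series_constant_eq0 H).
rewrite mulr0 add0r mulr_sumr; apply: eq_bigr => k _.
by rewrite exprS !mulrA mulVf // mul1r.
Qed.

Lemma expansion_unique p (phi : C -> 'M[C]_p) a a' s s' :
  expansion phi a s -> expansion phi a' s' ->
  forall k, alph a s k = alph a' s' k.
Proof.
move=> h h'.
have at0 c u : expansion phi c u -> 'i%C *: phi (mob 0) = c.
  have d0 : udisc (0 : C) by rewrite /udisc /= normr0.
  move=> /(_ 0 d0)/series_toE H; apply/eqP; rewrite -subr_eq0; apply/eqP.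
  apply: (mcvg_unique H); apply: mcvg_ext (@mcvg_cst R p p 0) => N.
  by rewrite big1 // => k _; rewrite expr0n scale0r.
case=> [|k] /=; first by rewrite -(at0 _ _ h) (at0 _ _ h').
apply/matrixP => i j; apply/eqP; rewrite -subr_eq0; apply/eqP.
apply: (power_series_eq0 (t := fun k => s k.+1 i j - s' k.+1 i j)) => z z0 z1.
have /series_toE H := h z z1; have /series_toE H' := h' z z1.
have := mcvgB H H'; rewrite -(at0 _ _ h) (at0 _ _ h') subrr => /(_ i j).
rewrite mxE => /(ccvgM (@ccvg_cst R z^-1)); rewrite mulr0; apply: ccvg_ext => N.
rewrite !mxE !summxE -sumrB mulr_sumr; apply: eq_bigr => l _.
by rewrite !mxE -mulrBr exprS !mulrA mulVf // mul1r.
Qed.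

End PowerSeries.

Section Mobius.
Variable R : realType.
Local Notation C := R[i].

Lemma Clower_norm (w : C) : Clower w <-> `|w + 'i%C| < `|w - 'i%C|.
Proof.
have -> : (`|w + 'i%C| < `|w - 'i%C|) = (complex.Im w < 0); last by [].
rewrite -(ltr_pXn2r (n := 2)) ?nnegrE // -subr_gt0 !normCK.
have -> : (w - 'i%C) * (w - 'i%C)^* - (w + 'i%C) * (w + 'i%C)^*
    = ((- (complex.Im w *+ 4))%:C)%C.
  case: w => x y; apply/eqP; rewrite eq_complex /=.
  by apply/andP; split; apply/eqP; ring.
by rewrite ltcR oppr_gt0 pmulrn_llt0.
Qed.

Lemma Clower_sub_neq0 (w : C) : Clower w -> w - 'i%C != 0.
Proof. by move/Clower_norm => h; rewrite -normr_gt0 (le_lt_trans _ h). Qed.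

Lemma imaginary_neq0 : ('i%C : C) != 0.
Proof. by rewrite eq_complex /= oner_eq0 andbF. Qed.

Definition imob (w : C) : C := (w + 'i%C) / (w - 'i%C).

Lemma udisc_imob (w : C) : Clower w -> udisc (imob w).
Proof.
move=> hw; rewrite /udisc /= /imob normrM normfV ltr_pdivrMr ?mul1r.
  exact/Clower_norm.
by rewrite normr_gt0 Clower_sub_neq0.
Qed.

Lemma imobK (w : C) : Clower w -> mob (imob w) = w.
Proof.
move=> /Clower_sub_neq0 h; have i0 := imaginary_neq0.
have e1 : imob w - 1 = 2 * 'i%C / (w - 'i%C) by rewrite /imob; field.
have e2 : imob w + 1 = 2 * w / (w - 'i%C) by rewrite /imob; field.
by rewrite /mob e1 e2; field; rewrite i0 h.
Qed.

Lemma udisc_sub1_neq0 (z : C) : udisc z -> z - 1 != 0.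
Proof.
by rewrite /udisc /= subr_eq0 => h; apply: contraTneq h => ->; rewrite normr1 ltxx.
Qed.

Lemma mobD (z : C) : udisc z -> mob z + 'i%C = z * (mob z - 'i%C).
Proof. by move=> /udisc_sub1_neq0 h; rewrite /mob; field. Qed.

Lemma Clower_mob (z : C) : udisc z -> Clower (mob z).
Proof.
move=> hz; apply/Clower_norm; rewrite mobD // normrM gtr_pMl //.
have h := udisc_sub1_neq0 hz.
have -> : mob z - 'i%C = 2 * 'i%C / (z - 1) by rewrite /mob; field.
by rewrite normr_gt0 !mulf_neq0 ?invr_eq0 ?pnatr_eq0 // imaginary_neq0.
Qed.

Lemma differentiable_mobius (a b c d : C) (z : C) : z - c != 0 ->
  differentiable (fun w : C^o => d * (w - b) / (w - c) : C^o) (z : C^o).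
Proof.
move=> zc; apply/derivable1_diffP.
have dsub e : derivable (fun w : C^o => w - e : C^o) (z : C^o) 1.
  by apply: derivableB; [exact: derivable_id | exact: derivable_cst].
apply: derivableM; first by apply: derivableM; [exact: derivable_cst | exact: dsub].
exact: derivableV.
Qed.

Lemma holomorphic_comp p (D E : set C) (g : C -> C) (f : C -> 'M[C]_p) k :
  (forall z, D z -> differentiable (g : C^o -> C^o) (z : C^o)) ->
  (forall z, D z -> E (g z)) -> holomorphic_on E f ->
  holomorphic_on D (fun z => k *: f (g z)).
Proof.
move=> dg gE hf z Dz.
apply: (@derivableZ C C^o (MX R p p) (f \o g)).
apply/derivable1_diffP.
apply: (@differentiable_comp C C^o C^o (MX R p p) g f); first exact: dg.
apply/derivable1_diffP; apply: hf; exact: gE.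
Qed.

Lemma Clower_near (w : C) : Clower w -> \forall v \near (w : C^o), Clower v.
Proof.
rewrite /Clower /= => w0; apply/nbhs_ballP.
exists ((- complex.Im w)%:C)%C; first by rewrite /= ltcR oppr_gt0.
move=> v; rewrite /ball /= => /(le_lt_trans (Im_norm_le _)); rewrite ltcR.
rewrite ltr_norml => /andP[+ _].
case: w v w0 => x y [x' y'] /= _; rewrite opprK ltrBrDl.
by rewrite -subr_gt0 => h; rewrite -subr_gt0 sub0r; move: h; lra.
Qed.

Lemma mob_as_ratio (z : C) : mob z = 'i%C * (z - (- 1)) / (z - 1).
Proof. by rewrite /mob opprK. Qed.

Lemma holomorphic_mob p (phi : C -> 'M[C]_p) :
  holomorphic_on (@Clower R) phi <-> holomorphic_on (@udisc R) (fun z => 'i%C *: phi (mob z)).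
Proof.
split=> h.
  apply: holomorphic_comp h => z hz; last exact: Clower_mob.
  have := @differentiable_mobius 0 (-1) 1 'i%C z (udisc_sub1_neq0 hz).
  by under eq_fun do rewrite -mob_as_ratio.
have hi : holomorphic_on (@Clower R) (fun w => - 'i%C *: ('i%C *: phi (mob (imob w)))).
  apply: (holomorphic_comp (f := fun z => 'i%C *: phi (mob z))) h => w hw.
    have := @differentiable_mobius 0 (- 'i%C) 'i%C 1 w (Clower_sub_neq0 hw).
    rewrite (_ : (fun _ => _) = (imob : C^o -> C^o)) //.
    by apply/funext => v; rewrite /imob mul1r opprK.
  exact: udisc_imob.
move=> w hw; apply: near_eq_derivable (hi w hw).
have := Clower_near hw; apply: filterS => v hv /=.
rewrite scalerA mulNr -expr2 (_ : ('i%C : C) ^+ 2 = -1) ?opprK ?scale1r ?imobK //.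
exact: sqr_i.
Qed.

End Mobius.

Section Blocks.
Variables (R : realType) (p : nat).
Local Notation C := R[i].
Local Notation J := (Jm R p).

Lemma adj_mxblock m n (B : 'I_m -> 'I_n -> 'M[C]_p) :
  adj (\mxblock_(k, j) B k j) = \mxblock_(k, j) adj (B j k).
Proof.
rewrite /adj (_ : map_mx _ _ = \mxblock_(k, j) map_mx Num.conj (B k j)).
  by rewrite tr_mxblock.
by apply/matrixP => x y; rewrite !mxE.
Qed.

Lemma adj_mxcol m q (B : 'I_m -> 'M[C]_(p, q)) :
  adj (\mxcol_k B k) = \mxrow_k adj (B k).
Proof.
rewrite /adj (_ : map_mx _ _ = \mxcol_k map_mx Num.conj (B k)).
  by rewrite tr_mxcol.
by apply/matrixP => x y; rewrite !mxE.
Qed.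

Section Size.
Variables (N : nat) (a : 'M[C]_p) (s : nat -> 'M[C]_p).
Let al := alph a s.

Lemma toeplitzE :
  toeplitz N a s = \mxblock_(k < N.+1, j < N.+1) toeplitz_entry al k j.
Proof.
apply: eq_mxblock => k j; rewrite /toeplitz_entry /al -val_eqE /=.
have [jk|kj|_] := ltngtP j k; last by [].
- by move: jk; rewrite -subn_gt0; case: (k - j)%N.
- by move: kj; rewrite -subn_gt0; case: (j - k)%N.
Qed.

Lemma PiN_E : PiN N a s
  = \mxcol_(k < N.+1) row_mx 1%:M (\sum_(l < k.+1) al l).
Proof.
apply/matrixP => x y; rewrite /PiN; case: (split_ordP y) => j ->.
  by rewrite row_mxEl [RHS]mxE row_mxEl [LHS]mxE.
by rewrite row_mxEr [RHS]mxE row_mxEr [LHS]mxE.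
Qed.

Lemma mul_AN (S : nat -> nat -> 'M[C]_p) :
  AN R p N *m (\mxblock_(k < N.+1, j < N.+1) S k j)
  = \mxblock_(k < N.+1, j < N.+1)
      ('i%C *: (2^-1 *: S k j + \sum_(m < k) S m j)).
Proof.
rewrite /AN mul_mxblock; apply: eq_mxblock => k j.
rewrite scalerDr scalerA -(big_mkord xpredT (fun m => S m j)).
rewrite -(big_mkord xpredT (fun m => (if (k < m)%N then 0 else
  if m == k then ('i%C / 2) *: 1%:M else 'i%C *: 1%:M) *m S m j)) //.
rewrite (big_cat_nat (n := k.+1)) //= [X in _ + X]big_nat [X in _ + X]big1 ?addr0; last first.
  by move=> m /andP[km _]; rewrite km mul0mx.
rewrite big_nat_recr //= ltnn eqxx -scalemxAl mul1mx addrC; congr (_ + _).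
rewrite scaler_sumr; apply: eq_big_nat => m /andP[_ mk].
by rewrite ltnNge (ltnW mk) /= ltn_eqF // -scalemxAl mul1mx.
Qed.

Lemma lyapunov_mxblock (S : nat -> nat -> 'M[C]_p) :
  let Sb := \mxblock_(k < N.+1, j < N.+1) S k j in
  AN R p N *m Sb - Sb *m adj (AN R p N) = \mxblock_(k < N.+1, j < N.+1)
      ('i%C *: (S k j + \sum_(m < k) S m j + \sum_(m < j) S k m)).
Proof.
move=> Sb; have eA := mul_AN S; have eA' := mul_AN (fun k j => adj (S j k)).
have -> : Sb *m adj (AN R p N) = adj (AN R p N *m adj Sb) by rewrite adjM adjK.
rewrite /Sb adj_mxblock eA eA' adj_mxblock -mxblockB; apply: eq_mxblock => k j.
rewrite adjZ adjD adjZ adjK adj_sum conj_imaginary scaleNr opprK -scalerDr.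
under [X in _ + (_ + X)]eq_bigr do rewrite adjK.
congr (_ *: _).
have -> : (2^-1 : C)^* = 2^-1 by apply: CrealP; rewrite ger0_real // invr_ge0 ler0n.
move: (\sum_(m < k) _) (\sum_(m < j) _) => S1 S2.
by apply/matrixP => x y; rewrite !mxE; field.
Qed.

Lemma PiN_J : PiN N a s *m J *m adj (PiN N a s) = \mxblock_(k < N.+1, j < N.+1)
  (\sum_(l < k.+1) al l + adj (\sum_(l < j.+1) al l)).
Proof.
rewrite PiN_E adj_mxcol mxcol_mul mul_mxcol_mxrow; apply: eq_mxblock => k j.
by rewrite row1_gramJ.
Qed.

Lemma lyapunov_entries (S' : 'M[C]_(\sum_(k < N.+1) p)) :
  AN R p N *m S' - S' *m adj (AN R p N)
    = 'i%C *: (PiN N a s *m J *m adj (PiN N a s)) <-> S' = toeplitz N a s.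
Proof.
have i0 := imaginary_neq0 R.
have scale_mxblock (B : 'I_N.+1 -> 'I_N.+1 -> 'M[C]_p) :
    'i%C *: (\mxblock_(k, j) B k j) = \mxblock_(k, j) ('i%C *: B k j).
  by apply/matrixP => x y; rewrite !mxE.
pose S k j : 'M[C]_p := submxblock S' (inord k) (inord j).
have SE : S' = \mxblock_(k < N.+1, j < N.+1) S k j.
  rewrite -[LHS]submxblockK; apply: eq_mxblock => k j.
  by rewrite /S !inord_val.
rewrite PiN_J scale_mxblock toeplitzE SE lyapunov_mxblock; split => [/eq_mxblockP h|/eq_mxblockP h].
  apply: eq_mxblock => k j; apply/eqP; rewrite -subr_eq0; apply/eqP.
  apply: (cumulative_eq0 (N := N.+1) (D := fun k j => S k j - toeplitz_entry al k j)) => //.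
  move=> {k j} k j kN jN; have := h (Ordinal kN) (Ordinal jN) => /= /(scalerI i0).
  rewrite -toeplitz_cumulative !sumrB.
  move: (\sum_(m < k) _) (\sum_(m < j) _) (\sum_(m < k) _) (\sum_(m < j) _).
  move=> S1 S2 S3 S4 /eqP; rewrite -subr_eq0 => /eqP <-.
  by apply/matrixP => x y; rewrite !mxE; ring.
apply: eq_mxblock => k j; rewrite -toeplitz_cumulative; congr (_ *: (_ + _ + _)).
- exact: h.
- by apply: eq_bigr => m _; exact: (h (Ordinal (ltn_trans (ltn_ord m) (ltn_ord k))) j).
- by apply: eq_bigr => m _; exact: (h k (Ordinal (ltn_trans (ltn_ord m) (ltn_ord j)))).
Qed.

Lemma toeplitz_positive_of_posdef :
  posdef (toeplitz N a s) -> forall (y : nat -> 'rV[C]_p) k, (k < N.+1)%N -> y k != 0 ->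
    0 < (\sum_(k < N.+1) \sum_(j < N.+1)
           y k *m toeplitz_entry al k j *m adj (y j)) 0 0.
Proof.
move=> [_ pos] y k kN yk.
pose v := \mxcol_(j < N.+1) adj (y j).
have v0 : v != 0.
  apply: contra_neq yk => v0; rewrite -[LHS]adjK.
  have := mxcolK (fun j : 'I_N.+1 => adj (y j)) (Ordinal kN).
  by rewrite -/v v0 submxcol0 /= => <-; rewrite adj0.
have := pos v v0; rewrite toeplitzE /v adj_mxcol.
rewrite mul_mxrow_mxblock mul_mxrow_mxcol.
suff -> : \sum_(j < N.+1) (\sum_(k < N.+1)
      adj (adj (y k)) *m toeplitz_entry al k j) *m adj (y j)
    = \sum_(k < N.+1) \sum_(j < N.+1) y k *m toeplitz_entry al k j *m adj (y j) by [].
rewrite exchange_big; apply: eq_bigr => j _ /=; rewrite mulmx_suml.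
by apply: eq_bigr => l _; rewrite adjK.
Qed.

Variables (b : nat -> 'M[C]_(p, p + p)) (X : nat -> nat -> 'M[C]_p).
Hypothesis lX : linked b al X.

Let Xb := \mxblock_(k < N.+1, j < N.+1) X k j.

Lemma toeplitz_factor : toeplitz N a s = Xb *m adj Xb.
Proof.
rewrite toeplitzE /Xb adj_mxblock mul_mxblock; apply: eq_mxblock => k j.
by rewrite (linked_toeplitz lX).
Qed.

Lemma mxblock_X_unit : Xb \in unitmx.
Proof.
apply: unitmx_kernel => v h.
pose y k : 'cV[C]_p := submxcol v (inord k).
have vE : v = \mxcol_(k < N.+1) y k.
  by rewrite -[LHS]submxcolK; apply: eq_mxcol => k; rewrite /y inord_val.
have z0 : (0 : 'cV[C]_(\sum_(k < N.+1) p)) = \mxcol_(k < N.+1) 0 by rewrite mxcol0.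
have y0 k : (k < N.+1)%N -> y k = 0.
  apply: (triangular_cancel (X := X) (n := N.+1) (E := y)).
  - exact: (linked_lower lX).
  - by move=> j _; exact: (linked_diag lX).
  - move=> j jN; move: h; rewrite vE /Xb mul_mxblock_mxrow.
    by rewrite z0 => /eq_mxcolP/(_ (Ordinal jN)).
by rewrite vE z0; apply: eq_mxcol => k; exact: y0.
Qed.

Lemma linked_posdef : posdef (toeplitz N a s).
Proof.
rewrite toeplitz_factor; split; first by rewrite adjM adjK.
move=> v v0; rewrite -/(hform _ v) -{1}[Xb]adjK lt_def hform_gram_ge0 andbT.
apply: contra_neq v0 => /hform_gram_eq0 h.
have u : adj Xb \in unitmx by rewrite unitmx_adj mxblock_X_unit.
by rewrite -[v](mulKmx u) h mulmx0.
Qed.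

Lemma linked_gram_sum : adj (PiN N a s) *m invmx (toeplitz N a s) *m PiN N a s
  = \sum_(k < N.+1) adj (b k) *m b k.
Proof.
pose B := \mxcol_(k < N.+1) b k.
have PE : PiN N a s = Xb *m B.
  rewrite PiN_E /Xb /B mul_mxblock_mxrow; apply: eq_mxcol => k.
  by rewrite (linked_rowsW lX).
have Xu := mxblock_X_unit.
have Xu' : adj Xb \in unitmx by rewrite unitmx_adj.
have Su : toeplitz N a s \in unitmx by rewrite toeplitz_factor unitmx_mul Xu.
have e : invmx (toeplitz N a s) = invmx (adj Xb) *m invmx Xb.
  rewrite -[RHS](mulKmx Su) -[LHS]mulmx1; congr (_ *m _).
  by rewrite toeplitz_factor -mulmxA (mulmxA (adj Xb)) mulmxV // mul1mx mulmxV.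
rewrite e PE adjM !mulmxA mulmxK // mulmxKV //.
by rewrite /B adj_mxcol mul_mxrow_mxcol.
Qed.

End Size.
End Blocks.

Section WeylExpansion.
Variables (R : realType) (p : nat).
Local Notation C := R[i].
Implicit Types (b : nat -> 'M[C]_(p, p + p)) (phi : C -> 'M[C]_p).

Lemma alph_fun (al : nat -> 'M[C]_p) : alph (al 0%N) al = al.
Proof. by apply/funext => -[]. Qed.

Lemma weyl_linked b phi : admissible b -> weyl_function b phi ->
  exists al X, linked b al X /\ expansion phi (al 0%N) al.
Proof.
move=> adm [_ hphi]; have [al [X lX]] := linked_of_admissible adm.
exists al, X; split=> // z hz.
have hw := Clower_mob hz.
have [l hl] := linked_series_cvg lX hz.
pose F := l + al 0%N.
have hF : series_to (fun k => z ^+ k.+1 *: al k.+1) (F - al 0%N) by rewrite addrK.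
pose phi' := fun _ : C => - 'i%C *: F.
have iphi' : 'i%C *: phi' (mob z) = F.
  rewrite scalerA mulrN -expr2 (_ : ('i%C : C) ^+ 2 = -1) ?opprK ?scale1r //.
  exact: sqr_i.
have -> : phi (mob z) = phi' (mob z).
  apply: (weyl_unique adm hw (hphi _ hw)); apply: (weyl_series_cvg adm hw) => n v.
  rewrite iphi'; apply: (linked_J_nonpositive lX hz hF hw).
  by rewrite mobD.
by rewrite iphi'.
Qed.

Lemma weyl_expansion_linked b phi a s : admissible b -> weyl_function b phi ->
  expansion phi a s -> exists X, linked b (alph a s) X.
Proof.
move=> adm hphi h; have [al [X [lX h']]] := weyl_linked adm hphi.
exists X; suff -> : alph a s = al by [].
by apply/funext => k; rewrite (expansion_unique h h') alph_fun.
Qed.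

Lemma weyl_caratheodory b phi : admissible b -> weyl_function b phi ->
  caratheodory (fun z => 'i%C *: phi (mob z)).
Proof.
move=> adm [hol hphi]; split; first exact/holomorphic_mob.
move=> z hz; have hw := Clower_mob hz; split; first by rewrite adjD adjK addrC.
move=> v; have := weyl_nonpositive adm hw (hphi _ hw) 0 v.
rewrite Wconj0 mul1mx /initial_vec mul_col_mx mul1mx hform_Jm.
move: ('i%C *: phi (mob z)) => F; rewrite mulNmx adjN mulNmx mulmxN.
have entryN (A : 'M[C]_1) : (- A) 0 0 = - A 0 0 by rewrite mxE.
rewrite !entryN -opprD oppr_le0.
suff -> : (adj v *m (F + adj F) *m v) 0 0
    = (adj (F *m v) *m v) 0 0 + (adj v *m (F *m v)) 0 0 by [].
by rewrite mulmxDr mulmxDl mxE adjM mulmxA addrC.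
Qed.

Lemma linked_weyl b phi a s X : linked b (alph a s) X -> expansion phi a s ->
  caratheodory (fun z => 'i%C *: phi (mob z)) -> weyl_function b phi.
Proof.
move=> lX h [hol _]; split; first exact/holomorphic_mob.
move=> w hw; apply: (weyl_series_cvg (linked_admissible lX) hw) => n v.
have hz := udisc_imob hw.
apply: (linked_J_nonpositive lX hz _ hw); first by have := h _ hz; rewrite imobK.
by rewrite -{2}(imobK hw) -mobD // imobK.
Qed.

End WeylExpansion.

Theorem theorem6p6 (R : realType) (p : nat) : (0 < p)%N ->
  (forall phi : R[i] -> 'M[R[i]]_p,
     (exists beta : nat -> 'M[R[i]]_(p, p + p),
        admissible beta /\ weyl_function beta phi)
     <->
     (exists (alpha0 : 'M[R[i]]_p) (s : nat -> 'M[R[i]]_p),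
        expansion phi alpha0 s /\
        caratheodory (fun z => 'i%C *: phi (mob z)) /\
        forall N : nat, posdef (toeplitz N alpha0 s)))
  /\
  (forall (beta : nat -> 'M[R[i]]_(p, p + p)) (phi : R[i] -> 'M[R[i]]_p)
          (alpha0 : 'M[R[i]]_p) (s : nat -> 'M[R[i]]_p),
     admissible beta -> weyl_function beta phi -> expansion phi alpha0 s ->
     forall N : nat,
       exists S : 'M[R[i]]_(\sum_(k < N.+1) p),
         (posdef S /\
          AN R p N *m S - S *m adj (AN R p N)
            = 'i%C *: (PiN N alpha0 s *m Jm R p *m adj (PiN N alpha0 s))) /\
         (forall S' : 'M[R[i]]_(\sum_(k < N.+1) p),
            posdef S' /\
            AN R p N *m S' - S' *m adj (AN R p N)
              = 'i%C *: (PiN N alpha0 s *m Jm R p *m adj (PiN N alpha0 s)) ->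
            S' = S) /\
         adj (PiN N alpha0 s) *m invmx S *m PiN N alpha0 s
           = \sum_(k < N.+1) adj (beta k) *m beta k)
  /\
  (forall (beta1 beta2 : nat -> 'M[R[i]]_(p, p + p)) (phi : R[i] -> 'M[R[i]]_p),
     admissible beta1 -> admissible beta2 ->
     weyl_function beta1 phi -> weyl_function beta2 phi ->
     forall k, Csys beta1 k = Csys beta2 k).
Proof.
move=> _; split; [move=> phi; split | split].
- move=> [b [adm hphi]]; have [al [X [lX h]]] := weyl_linked adm hphi.
  exists (al 0%N), al; split; first exact: h.
  split; first exact: (weyl_caratheodory adm hphi).
  move=> N; apply: (linked_posdef N (b := b) (X := X)).
  rewrite alph_fun; exact: lX.
- move=> [a [s [h [hc pos]]]].
  have [|b [X lX]] := @linked_of_toeplitz R p (alph a s).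
    by move=> [//|N] y k; exact: toeplitz_positive_of_posdef.
  by exists b; split; [exact: (linked_admissible lX) | exact: linked_weyl lX h hc].
- move=> b phi a s adm hphi h N; have [X lX] := weyl_expansion_linked adm hphi h.
  exists (toeplitz N a s); split; first split.
  + exact: linked_posdef lX.
  + exact/lyapunov_entries.
  + split; last exact: linked_gram_sum lX.
    by move=> S' [_ /lyapunov_entries].
- move=> b1 b2 phi adm1 adm2 h1 h2 k.
  have [al [X1 [lX1 h]]] := weyl_linked adm1 h1.
  have [X2 lX2] := weyl_expansion_linked adm2 h2 h.
  have sums n : \sum_(k < n) adj (b1 k) *m b1 k = \sum_(k < n) adj (b2 k) *m b2 k.
    case: n => [|N]; first by rewrite !big_ord0.
    have lX1' : linked b1 (alph (al 0%N) al) X1 by rewrite alph_fun; exact: lX1.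
    have e1 := linked_gram_sum N lX1'; have e2 := linked_gram_sum N lX2.
    exact: etrans (esym e1) e2.
  have e : adj (b1 k) *m b1 k = adj (b2 k) *m b2 k.
    by have := sums k.+1; rewrite !big_ord_recr sums /= => /addrI.
  by rewrite !Csys_signature /signature_mx e.
Qed.
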